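(* Let $L$ be a densely defined operator on $L^2(\mathbb{R}^n)$ satisfying (A2) (Gaussian upper bounds for the heat kernels) and (A3) (Hölder regularity of the heat kernels), and let $\varphi:\mathbb{R}^n\times[0,\infty)\to[0,\infty)$ be a growth function. Then the spaces $H_{\varphi,L,\max}(\mathbb{R}^n)$ and $H_{\varphi,L,\mathrm{rad}}(\mathbb{R}^n)$ coincide with equivalent quasi-norms.
   Context: **Assumptions on $L$.** $L$ generates a semigroup $\{e^{-tL}\}_{t>0}$ on $L^2(\mathbb{R}^n)$ with kernels $\{K_t\}_{t>0}$. (A2) The $K_t$ are measurable functions on $\mathbb{R}^n\times\mathbb{R}^n$ and there exist constants $C,c>0$ such that, for all $t\in(0,\infty)$ and $x,y\in\mathbb{R}^n$, $|K_t(x,y)|\le \frac{C}{t^{n/2}}\exp\{-\frac{|x-y|^2}{ct}\}$. (A3) There exist constants $C>0$ and $\mu\in(0,1]$ such that, for all $t\in(0,\infty)$ and $x,y_1,y_2\in\mathbb{R}^n$, $|K_t(y_1,x)-K_t(y_2,x)|\le\frac{C}{t^{n/2}}\frac{|y_1-y_2|^\mu}{t^{\mu/2}}$. **Growth functions.** An Orlicz function is a non-decreasing $\Phi:[0,\infty)\to[0,\infty)$ with $\Phi(0)=0$, $\Phi(t)>0$ for $t>0$ and $\lim_{t\to\infty}\Phi(t)=\infty$ (convexity is not required). A function $\varphi:\mathbb{R}^n\times[0,\infty)\to[0,\infty)$ with $\varphi(x,\cdot)$ an Orlicz function for every $x$ is of uniformly upper (resp. lower) type $p\in(0,\infty)$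 if there is $C>0$ such that $\varphi(x,st)\le Cs^p\varphi(x,t)$ for all $x\in\mathbb{R}^n$, $t\in[0,\infty)$ and $s\in[1,\infty)$ (resp. $s\in[0,1]$). Let $\varphi(\cdot,t)$ be measurable for all $t$. For $q\in(1,\infty)$, $\varphi\in\mathbb{A}_q(\mathbb{R}^n)$ means $$\sup_{t\in(0,\infty)}\sup_{B}\frac1{|B|^q}\int_B\varphi(x,t)\,dx\Big\{\int_B[\varphi(y,t)]^{-1/(q-1)}dy\Big\}^{q-1}<\infty,$$ and $\varphi\in\mathbb{A}_1(\mathbb{R}^n)$ means $\sup_{t\in(0,\infty)}\sup_B\frac1{|B|}\int_B\varphi(x,t)\,dx\,\{\operatorname{ess\,sup}_{y\in B}[\varphi(y,t)]^{-1}\}<\infty$, the suprema over $B$ being over all balls of $\mathbb{R}^n$. $\mathbb{A}_\infty(\mathbb{R}^n):=\bigcup_{q\in[1,\infty)}\mathbb{A}_q(\mathbb{R}^n)$. $\varphi$ is a growth function if: $\varphi(x,\cdot)$ is an Orlicz function for all $x$; $\varphi(\cdot,t)$ is measurable for all $t\in[0,\infty)$; $\varphi\in\mathbb{A}_\infty(\mathbb{R}^n)$; and $\varphi$ is of uniformly lower type $p$ for some $p\in(0,1]$ and of uniformly upper type $1$. $L^\varphi(\mathbb{R}^n)$ is the set of measurable $f$ with $\int_{\mathbb{R}^n}\varphi(x,|f(x)|)dx<\infty$, with quasi-norm $\|f\|_{L^\varphi(\mathbb{R}^n)}:=\inf\{\lambda\in(0,\infty):\int_{\mathbb{R}^n}\varphi(x,|f(x)|/\lambda)\,dx\le1\}$.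 **Maximal functions and spaces.** For $f\in L^2(\mathbb{R}^n)$ and $x\in\mathbb{R}^n$, the non-tangential and radial maximal functions are $$f^*_L(x):=\sup_{|y-x|<t,\,t\in(0,\infty)}|e^{-t^2L}(f)(y)|,\qquad f^+_L(x):=\sup_{t\in(0,\infty)}|e^{-t^2L}(f)(x)|,$$ where $e^{-sL}(f)(y)=\int_{\mathbb{R}^n}K_s(y,z)f(z)\,dz$. $H_{\varphi,L,\max}(\mathbb{R}^n)$ is the completion of $\{f\in L^2(\mathbb{R}^n):f^*_L\in L^\varphi(\mathbb{R}^n)\}$ with respect to the quasi-norm $\|f^*_L\|_{L^\varphi(\mathbb{R}^n)}$; $H_{\varphi,L,\mathrm{rad}}(\mathbb{R}^n)$ is the completion of $\{f\in L^2(\mathbb{R}^n):f^+_L\in L^\varphi(\mathbb{R}^n)\}$ with respect to the quasi-norm $\|f^+_L\|_{L^\varphi(\mathbb{R}^n)}$. The two spaces coincide with equivalent quasi-norms when these defining subsets of $L^2(\mathbb{R}^n)$ are equal and the two quasi-norms are equivalent on them, so that the completions are identified. *)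

(* Defs.v *)
From HB Require Import structures.
From mathcomp Require Import all_boot all_order all_algebra complex.
From mathcomp Require Import all_classical all_reals all_analysis.
From mathcomp Require Import ess_sup_inf measurable_realfun.

Set Implicit Arguments.
Unset Strict Implicit.
Unset Printing Implicit Defensive.

Import Order.TTheory GRing.Theory Num.Theory.
Import numFieldNormedType.Exports.

Local Open Scope classical_set_scope.
Local Open Scope ring_scope.

(* R^n is [n.-tuple R]: the library equips tuples with the product sigma-algebra
   of the Borel sets of R, that is, the Borel sets of R^n.  Its Euclidean
   metric is [eucl_dist] below. *)
Notation Rn R n := (n.-tuple (measurableTypeR R)).

Definition cons_pair (R : realType) (n : nat)
  (p : Rn R n * measurableTypeR R) : Rn R n.+1 := [the Rn R n.+1 of p.2 :: p.1].

Lemma measurable_cons_pair (R : realType) (n : nat) :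
  measurable_fun [set: Rn R n * measurableTypeR R] (@cons_pair R n).
Proof. exact: measurable_cons. Qed.

Definition uncons_pair (R : realType) (n : nat)
  (x : Rn R n.+1) : Rn R n * measurableTypeR R :=
  ([the Rn R n of [tuple of behead x]], thead x).

Lemma measurable_uncons_pair (R : realType) (n : nat) :
  measurable_fun [set: Rn R n.+1] (@uncons_pair R n).
Proof.
apply: measurable_fun_pair; first exact: measurable_behead.
exact: (@measurable_tnth _ (measurableTypeR R) n.+1 ord0).
Qed.

Lemma cons_pairK (R : realType) (n : nat) :
  cancel (@cons_pair R n) (@uncons_pair R n).
Proof.
move=> [v a]; rewrite /uncons_pair /cons_pair /=; congr pair.
by apply: val_inj.
Qed.

Definition lebesgue_succ (R : realType) (n : nat)
    (m : {sigma_finite_measure set (Rn R n) -> \bar R}) :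
    set (Rn R n.+1) -> \bar R :=
  pushforward (m \x (@lebesgue_measure R))%E (@cons_pair R n).

HB.instance Definition _ (R : realType) (n : nat)
    (m : {sigma_finite_measure set (Rn R n) -> \bar R}) :=
  Measure.copy (lebesgue_succ m)
    (@measure_function_pushforward__canonical__measure_function_Measure
       _ _ _ _ _ (m \x (@lebesgue_measure R))%E _ (@measurable_cons_pair R n)).

Lemma sigma_finite_lebesgue_succ (R : realType) (n : nat)
    (m : {sigma_finite_measure set (Rn R n) -> \bar R}) :
  sigma_finite [set: Rn R n.+1] (lebesgue_succ m).
Proof.
have /sigma_finiteP[F [FT ndF mF]] := sigma_finiteT m.
have /sigma_finiteP[G [GT ndG mG]] := sigma_finiteT (@lebesgue_measure R).
exists (fun k => @uncons_pair R n @^-1` (F k `*` G k)).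
  rewrite -preimage_bigcup (_ : \bigcup_k _ = setT) ?preimage_setT//.
  apply/seteqP; split => // -[x y] _.
  have [i _ Fix] : (\bigcup_i F i) x by rewrite -FT.
  have [j _ Gjy] : (\bigcup_i G i) y by rewrite -GT.
  exists (maxn i j) => //; split => /=.
    by move: x Fix; exact/subsetPset/ndF/leq_maxl.
  by move: y Gjy; exact/subsetPset/ndG/leq_maxr.
move=> k; have [mFk Fk] := mF k; have [mGk Gk] := mG k; split.
  rewrite -[X in measurable X]setTI.
  by apply: measurable_uncons_pair => //; exact: measurableX.
rewrite /lebesgue_succ /pushforward -comp_preimage.
rewrite (_ : @uncons_pair R n \o _ = id) ?preimage_id; last first.
  by apply/funext => p /=; rewrite cons_pairK.
by rewrite product_measure1E// lte_mul_pinfty// ge0_fin_numE.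
Qed.

HB.instance Definition _ (R : realType) (n : nat)
    (m : {sigma_finite_measure set (Rn R n) -> \bar R}) :=
  @Measure_isSigmaFinite.Build _ _ R (lebesgue_succ m)
    (sigma_finite_lebesgue_succ m).

(* n-fold product of the Lebesgue measure of R, on the Borel sets of R^n *)
Fixpoint lebesgue_rn (R : realType) (n : nat) :
    {sigma_finite_measure set (Rn R n) -> \bar R} :=
  if n is n'.+1 then lebesgue_succ (lebesgue_rn R n')
  else \d_([tuple] : Rn R 0).

Definition eucl_dist (R : realType) (n : nat) (x y : Rn R n) : R :=
  Num.sqrt (\sum_(i < n) (tnth x i - tnth y i) ^+ 2).

Definition eucl_ball (R : realType) (n : nat) (x : Rn R n) (r : R) :
    set (Rn R n) :=
  [set y | eucl_dist y x < r].

(* Measurability with respect to the [mu]-completion of the sigma-algebra.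
   For [mu := lebesgue_rn R n] this is Lebesgue measurability.  The library's
   integral, being the difference of two suprema of integrals of
   simple functions, takes the expected value on such functions. *)
Definition ae_measurable d d' (T : measurableType d) (U : measurableType d')
    (R : realType) (mu : {measure set T -> \bar R}) (f : T -> U) : Prop :=
  exists2 g : T -> U, measurable_fun setT g & f = g %[ae mu].

Notation cmod := Normc.normc.

Definition ae_measurableC d (T : measurableType d) (R : realType)
    (mu : {measure set T -> \bar R}) (f : T -> R[i]) : Prop :=
  ae_measurable mu (fun x => complex.Re (f x) : measurableTypeR R) /\
  ae_measurable mu (fun x => complex.Im (f x) : measurableTypeR R).

Definition integralC d (T : measurableType d) (R : realType)
    (mu : {measure set T -> \bar R}) (f : T -> R[i]) : R[i] :=
  Complex (\int[mu]_x complex.Re (f x)) (\int[mu]_x complex.Im (f x)).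

Definition L2norm (R : realType) (n : nat) (f : Rn R n -> R[i]) : \bar R :=
  ('N[lebesgue_rn R n]_(2%:E) [EFin \o (@cmod R \o f)])%E.

(* Elements of the complex space L^2(R^n) are represented by functions; two
   functions represent the same element when they are equal a.e. *)
Definition L2 (R : realType) (n : nat) (f : Rn R n -> R[i]) : Prop :=
  ae_measurableC (lebesgue_rn R n) f /\ (L2norm f < +oo)%E.

(* A linear operator [L] on L^2(R^n) with domain [D], compatible with a.e.
   equality and such that [D] is dense. *)
Record densely_defined_operator (R : realType) (n : nat)
    (D : set (Rn R n -> R[i])) (L : (Rn R n -> R[i]) -> (Rn R n -> R[i])) :
    Prop := {
  operator_domL2 : forall f, D f -> L2 f ;
  operator_L2 : forall f, D f -> L2 (L f) ;
  operator_dom_ae : forall f g, D f -> L2 g ->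
    f = g %[ae lebesgue_rn R n] -> D g ;
  operator_ae : forall f g, D f -> D g ->
    f = g %[ae lebesgue_rn R n] -> L f = L g %[ae lebesgue_rn R n] ;
  operator_dom_linear : forall (a : R[i]) f g, D f -> D g ->
    D (fun x => a * f x + g x) ;
  operator_linear : forall (a : R[i]) f g, D f -> D g ->
    L (fun x => a * f x + g x) = (fun x => a * L f x + L g x)
      %[ae lebesgue_rn R n] ;
  operator_dense : forall f (e : R), L2 f -> 0 < e ->
    exists2 g, D g & (L2norm (fun x => f x - g x)%R < e%:E)%E
}.

(* [T] is a strongly continuous semigroup (T_t)_{t > 0} of bounded linear
   operators on L^2(R^n). *)
Record C0_semigroup (R : realType) (n : nat)
    (T : R -> (Rn R n -> R[i]) -> (Rn R n -> R[i])) : Prop := {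
  semigroup_L2 : forall (t : R) f, 0 < t -> L2 f -> L2 (T t f) ;
  semigroup_linear : forall (t : R) (a : R[i]) f g, 0 < t -> L2 f -> L2 g ->
    T t (fun x => a * f x + g x) = (fun x => a * T t f x + T t g x)
      %[ae lebesgue_rn R n] ;
  semigroup_bounded : forall t : R, 0 < t -> exists M : R, forall f, L2 f ->
    (L2norm (T t f) <= M%:E * L2norm f)%E ;
  semigroupD : forall (s t : R) f, 0 < s -> 0 < t -> L2 f ->
    T (s + t) f = T s (T t f) %[ae lebesgue_rn R n] ;
  semigroup_continuous : forall f, L2 f ->
    L2norm (fun x => T t f x - f x) @[t --> 0^'+] --> 0%E
}.

(* [g] is the limit of (f - T_t f) / t in L^2(R^n) as t decreases to 0 *)
Definition semigroup_derivative (R : realType) (n : nat)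
    (T : R -> (Rn R n -> R[i]) -> (Rn R n -> R[i])) (f g : Rn R n -> R[i]) :
    Prop :=
  L2norm (fun x => real_complex R t^-1 * (f x - T t f x) - g x)
    @[t --> 0^'+] --> 0%E.

(* T_t = e^{-tL}: the infinitesimal generator of [T] is - L, with the same
   domain. *)
Definition generates (R : realType) (n : nat)
    (D : set (Rn R n -> R[i])) (L : (Rn R n -> R[i]) -> (Rn R n -> R[i]))
    (T : R -> (Rn R n -> R[i]) -> (Rn R n -> R[i])) : Prop :=
  [/\ C0_semigroup T,
      (forall f, D f <->
         L2 f /\ exists2 g, L2 g & semigroup_derivative T f g) &
      (forall f, D f -> semigroup_derivative T f (L f))].

Definition kernel_op (R : realType) (n : nat)
    (K : R -> Rn R n -> Rn R n -> R[i]) (s : R) (f : Rn R n -> R[i]) :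
    Rn R n -> R[i] :=
  fun x => integralC (lebesgue_rn R n) (fun y => K s x y * f y).

Definition has_kernels (R : realType) (n : nat)
    (T : R -> (Rn R n -> R[i]) -> (Rn R n -> R[i]))
    (K : R -> Rn R n -> Rn R n -> R[i]) : Prop :=
  forall (t : R) f, 0 < t -> L2 f ->
    T t f = kernel_op K t f %[ae lebesgue_rn R n].

Definition gaussian_bound (R : realType) (n : nat)
    (K : R -> Rn R n -> Rn R n -> R[i]) : Prop :=
  (forall t : R, 0 < t ->
     ae_measurableC (lebesgue_rn R n \x lebesgue_rn R n)%E
       (fun p => K t p.1 p.2)) /\
  exists C c : R, [/\ 0 < C, 0 < c &
    forall (t : R) x y, 0 < t ->
      cmod (K t x y) <=
        C / t `^ (n%:R / 2) * expR (- (eucl_dist x y ^+ 2 / (c * t)))].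

Definition hoelder_kernel (R : realType) (n : nat)
    (K : R -> Rn R n -> Rn R n -> R[i]) : Prop :=
  exists C mu : R, [/\ 0 < C, 0 < mu <= 1 &
    forall (t : R) x y1 y2, 0 < t ->
      cmod (K t y1 x - K t y2 x) <=
        C / t `^ (n%:R / 2) * (eucl_dist y1 y2 `^ mu / t `^ (mu / 2))].

(* Functions on [0, oo) are functions on R, whose values at negative
   arguments are irrelevant. *)
Definition orlicz_function (R : realType) (Phi : R -> R) : Prop :=
  [/\ forall s t : R, 0 <= s -> s <= t -> Phi s <= Phi t,
      Phi 0 = 0,
      forall t : R, 0 < t -> 0 < Phi t &
      Phi t @[t --> +oo] --> +oo].

Definition uniformly_lower_type (R : realType) (n : nat)
    (phi : Rn R n -> R -> R) (p : R) : Prop :=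
  exists2 C : R, 0 < C & forall x (t s : R), 0 <= t -> 0 <= s <= 1 ->
    phi x (s * t) <= C * s `^ p * phi x t.

Definition uniformly_upper_type (R : realType) (n : nat)
    (phi : Rn R n -> R -> R) (p : R) : Prop :=
  exists2 C : R, 0 < C & forall x (t s : R), 0 <= t -> 1 <= s ->
    phi x (s * t) <= C * s `^ p * phi x t.

Definition muckenhoupt_constant (R : realType) (n : nat)
    (phi : Rn R n -> R -> R) (q t : R) (B : set (Rn R n)) : \bar R :=
  let mu := lebesgue_rn R n in
  ((mu B `^ q)^-1 * (\int[mu]_(x in B) (phi x t)%:E) *
   (\int[mu]_(y in B) (phi y t `^ (- (q - 1)^-1))%:E) `^ (q - 1))%E.

(* The essential supremum over B is that of the extension by 0, the function
   being positive on B. *)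
Definition muckenhoupt_constant1 (R : realType) (n : nat)
    (phi : Rn R n -> R -> R) (t : R) (B : set (Rn R n)) : \bar R :=
  let mu := lebesgue_rn R n in
  ((mu B)^-1 * (\int[mu]_(x in B) (phi x t)%:E) *
   ess_sup mu ((fun y => (phi y t)^-1%:E) \_ B))%E.

Definition muckenhoupt (R : realType) (n : nat)
    (phi : Rn R n -> R -> R) (q : R) : Prop :=
  (ereal_sup [set z | exists (t : R) (x : Rn R n) (r : R),
     [/\ (0 < t)%R, (0 < r)%R &
         z = if q == 1%R then muckenhoupt_constant1 phi t (eucl_ball x r)
             else muckenhoupt_constant phi q t (eucl_ball x r)]] < +oo)%E.

Definition muckenhoupt_infty (R : realType) (n : nat)
    (phi : Rn R n -> R -> R) : Prop :=
  exists2 q : R, 1 <= q & muckenhoupt phi q.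

Definition growth_function (R : realType) (n : nat)
    (phi : Rn R n -> R -> R) : Prop :=
  [/\ forall x, orlicz_function (phi x),
      forall t : R, 0 <= t ->
        ae_measurable (lebesgue_rn R n) (phi ^~ t : _ -> measurableTypeR R),
      muckenhoupt_infty phi,
      exists2 p : R, 0 < p <= 1 & uniformly_lower_type phi p &
      uniformly_upper_type phi 1].

(* [phi x] extended to [0, +oo] by its limit +oo at infinity, because the
   maximal functions below may be infinite at some points *)
Definition growth_ext (R : realType) (n : nat) (phi : Rn R n -> R -> R)
    (x : Rn R n) (u : \bar R) : \bar R :=
  if u is r%:E then (phi x r)%:E else +oo%E.

Definition modular (R : realType) (n : nat) (phi : Rn R n -> R -> R)
    (f : Rn R n -> \bar R) (l : R) : \bar R :=
  (\int[lebesgue_rn R n]_x growth_ext phi x (`|f x| * l^-1%:E))%E.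

Definition Lphi (R : realType) (n : nat) (phi : Rn R n -> R -> R) :
    set (Rn R n -> \bar R) :=
  [set f : Rn R n -> \bar R |
     ae_measurable (lebesgue_rn R n) f /\ (modular phi f 1 < +oo)%E].

Definition Lphi_norm (R : realType) (n : nat) (phi : Rn R n -> R -> R)
    (f : Rn R n -> \bar R) : \bar R :=
  ereal_inf [set l%:E | l in [set l : R | 0 < l /\ (modular phi f l <= 1)%E]].

Definition nontangential_max (R : realType) (n : nat)
    (K : R -> Rn R n -> Rn R n -> R[i]) (f : Rn R n -> R[i]) (x : Rn R n) :
    \bar R :=
  ereal_sup [set z | exists (y : Rn R n) (t : R),
    [/\ 0 < t, eucl_dist y x < t &
        z = (cmod (kernel_op K (t ^+ 2) f y))%:E]].

Definition radial_max (R : realType) (n : nat)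
    (K : R -> Rn R n -> Rn R n -> R[i]) (f : Rn R n -> R[i]) (x : Rn R n) :
    \bar R :=
  ereal_sup [set (cmod (kernel_op K (t ^+ 2) f x))%:E | t in [set t : R | 0 < t]].

(* The subspace of L^2(R^n) and the quasi-norm on it whose completion is the
   Hardy space attached to the maximal function [M]. *)
Definition hardy_dom (R : realType) (n : nat) (phi : Rn R n -> R -> R)
    (M : (Rn R n -> R[i]) -> Rn R n -> \bar R) : set (Rn R n -> R[i]) :=
  [set f | L2 f /\ Lphi phi (M f)].

Definition hardy_norm (R : realType) (n : nat) (phi : Rn R n -> R -> R)
    (M : (Rn R n -> R[i]) -> Rn R n -> \bar R) (f : Rn R n -> R[i]) : \bar R :=
  Lphi_norm phi (M f).

(* The completions coincide, with equivalent quasi-norms, when the spaces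
   being completed are equal and carry equivalent quasi-norms. *)
Definition hardy_spaces_coincide (R : realType) (n : nat)
    (phi : Rn R n -> R -> R)
    (M1 M2 : (Rn R n -> R[i]) -> Rn R n -> \bar R) : Prop :=
  hardy_dom phi M1 = hardy_dom phi M2 /\
  exists2 C : R, 0 < C & forall f, hardy_dom phi M1 f ->
    (hardy_norm phi M1 f <= C%:E * hardy_norm phi M2 f)%E /\
    (hardy_norm phi M2 f <= C%:E * hardy_norm phi M1 f)%E.

(* Main.v *)
Require Import Defs.
From mathcomp Require Import all_boot all_order all_algebra complex.
From mathcomp Require Import all_classical all_reals all_analysis.
From mathcomp Require Import ess_sup_inf measurable_realfun.
From mathcomp Require Import lra ring.

Set Implicit Arguments.
Unset Strict Implicit.
Unset Printing Implicit Defensive.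

Import Order.TTheory GRing.Theory Num.Theory.
Import numFieldNormedType.Exports.

Local Open Scope classical_set_scope.
Local Open Scope ring_scope.

(** Write u(t, y) = |exp(-t^2 L) f (y)|, and f+ and f* for the radial and the
    non-tangential maximal functions. As f+ <= f* pointwise, the point is to
    bound the modular of f* by that of f+.

    The bound is the argument of Fefferman and Stein. The semigroup law and the
    Hoelder regularity of the kernels prevent a nearly maximal value of
    u(t, y) (1 + |x - y|/t)^-N from being isolated: u(t, .) is comparable with it
    on a ball of radius delta t around y ([fefferman_stein]). On that ball
    u(t, .) <= f+. Averaging (f+)^r over a ball of radius comparable with
    |x - y| + t, with N r = n so that the weight pays for the ratio of the two
    volumes, gives f* <= C M((f+)^r)^(1/r), where M is the Hardy-Littlewood
    maximal function ([nontangential_le_maximal_radial]). This holds at every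
    point, for every r = 1/m.

    It remains to bound M((f+)^r)^(1/r) in L^phi. The weights phi(., t) satisfy
    an A_q condition uniformly in t, hence M is of weak type (q, q) for all of
    them with one constant ([weak_type], [muckenhoupt_weight]). Apply this at
    each dyadic level with the weight of that level and with the function
    truncated from below at that level, and sum over the levels: since phi is of
    lower type p, the sums over the levels are geometric as soon as r q < p
    ([modular_inequality]). Lastly, the lower type turns the constant in front of
    the modular into a dilation, that is, into a constant in front of the
    quasi-norm ([modular_shrink]).

    Two features of the setting shape the formulation. First, phi(x, .) is only
    monotone, so x |-> phi(x, f(x)) may fail to be measurable; its integral is a
    lower integral, and it is only ever compared, from above and from below,
    with integrals of Borel functions. Second, the kernels are jointly measurable
    and form a semigroup only up to null sets; as the Hoelder bound
    makes the operators map L^2 to continuous functions, these identities are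
    upgraded to every point, and the maximal functions are lower semicontinuous. *)

(** * Integrals of functions that need not be measurable *)

Section lower_integral.
Context d (T : measurableType d) (R : realType).
Variable mu : {measure set T -> \bar R}.
Implicit Types (f g : T -> \bar R).
Local Open Scope ereal_scope.
Import HBNNSimple.

(** The integral of a nonnegative function is the supremum of the integrals of
    the simple functions below it. A simple function below [f], once set to 0
    on a null set, lies below [g] and keeps its integral, whether or not [f]
    and [g] are measurable. This is what makes modulars of growth functions tractable:
    x |-> phi(x, f(x)) need not be measurable when phi(x, .) has jumps. *)
Lemma ge0_ae_le_integral f g : (forall x, 0 <= f x) -> (forall x, 0 <= g x) ->
  (\forall x \ae mu, f x <= g x) -> \int[mu]_x f x <= \int[mu]_x g x.
Proof.
move=> f0 g0 [N [mN N0 Nfg]].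
rewrite ge0_integralTE// [leRHS]ge0_integralTE//.
apply: ge_ereal_sup => _ [h hf <-].
have mNC : measurable (~` N) by exact: measurableC.
pose h' := proj_nnsfun h mNC.
have -> : sintegral mu h = sintegral mu h'.
  rewrite -!integralT_nnsfun; apply: ge0_ae_eq_integral => //.
  - by apply/measurable_EFinP.
  - by apply/measurable_EFinP.
  - by move=> x _; rewrite lee_fin.
  - by move=> x _; rewrite lee_fin.
  - exists N; split => // x /= /not_implyP[_ hh'].
    apply: contrapT => Nx; apply: hh'.
    rewrite /h' /= mindicE mem_set ?mulr1//.
apply: ereal_sup_ubound; exists h' => // x /=.
rewrite mindicE; case: (boolP (x \in ~` N)) => [/set_mem Nx|_].
  rewrite mulr1; apply: le_trans (hf x) _.
  by apply: contrapT => fg; apply: Nx; exact: Nfg.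
by rewrite mulr0.
Qed.

Lemma ge0_le_lower_integral (D : set T) f g : (forall x, D x -> 0 <= f x) ->
  (forall x, D x -> 0 <= g x) ->
  (forall x, D x -> f x <= g x) -> \int[mu]_(x in D) f x <= \int[mu]_(x in D) g x.
Proof.
move=> f0 g0 fg; rewrite integral_mkcond [leRHS]integral_mkcond.
apply: ge0_ae_le_integral => [x|x|]; [exact: erestrict_ge0|exact: erestrict_ge0|].
by apply: aeW => x; exact: lee_restrict.
Qed.

Lemma ge0_ae_le_integral_in (D : set T) f g : (forall x, D x -> 0 <= f x) ->
  (forall x, D x -> 0 <= g x) ->
  (\forall x \ae mu, D x -> f x <= g x) ->
  \int[mu]_(x in D) f x <= \int[mu]_(x in D) g x.
Proof.
move=> f0 g0 fg; rewrite integral_mkcond [leRHS]integral_mkcond.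
apply: ge0_ae_le_integral => [x|x|]; [exact: erestrict_ge0|exact: erestrict_ge0|].
apply: filterS fg => x; rewrite !patchE; case: ifPn => // /set_mem Dx; exact.
Qed.

Lemma ge0_ae_eq_lower_integral f g :
  (forall x, 0 <= f x) -> (forall x, 0 <= g x) ->
  (\forall x \ae mu, f x = g x) -> \int[mu]_x f x = \int[mu]_x g x.
Proof.
move=> f0 g0 fg; apply/eqP; rewrite eq_le; apply/andP; split.
  by apply: ge0_ae_le_integral => //; apply: filterS fg => x ->.
by apply: ge0_ae_le_integral => //; apply: filterS fg => x ->.
Qed.

Lemma ae_eq_lower_integral (D : set T) f g :
  (\forall x \ae mu, f x = g x) -> \int[mu]_(x in D) f x = \int[mu]_(x in D) g x.
Proof.
move=> fg; rewrite integral_mkcond [RHS]integral_mkcond.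
rewrite integralE [RHS]integralE; congr (_ - _).
  apply: ge0_ae_eq_lower_integral => //.
  by apply: filterS fg => x fg; rewrite !funeposE !patchE fg.
apply: ge0_ae_eq_lower_integral => //.
by apply: filterS fg => x fg; rewrite !funenegE !patchE fg.
Qed.

Lemma ge0_lower_integralZl_le (c : R) f : (0 < c)%R -> (forall x, 0 <= f x) ->
  \int[mu]_x (c%:E * f x) <= c%:E * \int[mu]_x f x.
Proof.
move=> c0 f0; rewrite ge0_integralTE; last first.
  by move=> x; rewrite mule_ge0// lee_fin ltW.
apply: ge_ereal_sup => _ [h hf <-].
have ci0 : (0 <= c^-1)%R by rewrite invr_ge0 ltW.
rewrite -lee_pdivrMl//; pose h' := scale_nnsfun h ci0.
have -> : c^-1%:E * sintegral mu h = sintegral mu h' by rewrite -sintegralrM.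
rewrite ge0_integralTE//; apply: ereal_sup_ubound; exists h' => // x /=.
by rewrite EFinM lee_pdivrMl.
Qed.

End lower_integral.

Section ae_measurable.
Context d (T : measurableType d) (R : realType).
Variable mu : {measure set T -> \bar R}.

Lemma ae_measurable_comp2 d1 d2 d3 (U1 : measurableType d1) (U2 : measurableType d2)
    (V : measurableType d3)
    (f1 : T -> U1) (f2 : T -> U2) (j : U1 * U2 -> V) : measurable_fun setT j ->
  ae_measurable mu f1 -> ae_measurable mu f2 -> ae_measurable mu (fun x => j (f1 x, f2 x)).
Proof.
move=> mj [g1 mg1 fg1] [g2 mg2 fg2]; exists (fun x => j (g1 x, g2 x)).
  by apply: measurableT_comp => //; exact: measurable_fun_pair.
by apply: filterS2 fg1 fg2 => x /= H1 H2 _; rewrite H1// H2.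
Qed.

Lemma ae_measurable_fun_ae d' (U : measurableType d') (f : T -> U) :
  measurable_fun setT f -> ae_measurable mu f.
Proof. by move=> mf; exists f => //; exact: aeW. Qed.

(** The approximating functions agree with Borel functions off one null set;
    after setting them to 0 on it, the Borel functions converge everywhere. *)
Lemma ae_measurable_cvg (f : nat -> T -> measurableTypeR R) (g : T -> measurableTypeR R) :
  (forall k, ae_measurable mu (f k)) ->
  (forall x, (f k x : R) @[k --> \oo] --> (g x : R)) ->
  ae_measurable mu g.
Proof.
move=> mf fg.
have /choice[h hP] : forall k, exists h : T -> measurableTypeR R,
    measurable_fun setT h /\ \forall x \ae mu, f k x = h x.
  move=> k; have [h mh fh] := mf k; exists h; split => //.
  by apply: filterS fh => x; exact.
have [N [mN N0 Nfh]] : \forall x \ae mu, forall k, f k x = h k x.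
  by apply: ae_foralln => k; have [] := hP k.
have fhN x : (~` N) x -> forall k, f k x = h k x.
  by move=> Nx; apply: contrapT => fh; apply: Nx; exact: Nfh.
have mNC : measurable (~` N) by exact: measurableC.
exists ((g : T -> R) \_ (~` N)); last first.
  exists N; split => // x /= /not_implyP[_ gx].
  apply: contrapT => Nx; apply: gx; rewrite patchE mem_set//.
pose hN k := (h k : T -> R) \_ (~` N).
apply: (@measurable_fun_cvg _ _ _ _ hN) => [k|x _].
  apply/(measurable_restrictT _ _).1 => //; apply: measurable_funTS.
  by have [] := hP k.
have [Nx|Nx] := pselect ((~` N) x).
  rewrite /hN patchE mem_set// (_ : (fun k => _) = (fun k => f k x)); first exact: fg.
  by apply/funext => k; rewrite /= patchE mem_set// fhN.
rewrite /hN patchE memNset// (_ : (fun k => _) = cst 0); first exact: cvg_cst.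
by apply/funext => k; rewrite /= patchE memNset.
Qed.

End ae_measurable.

(** * Euclidean balls and their measure *)

Section euclidean_space.
Context (R : realType).

Lemma sum_sqr_cauchy_schwarz (n : nat) (a b : 'I_n -> R) :
  \sum_i a i * b i <= Num.sqrt (\sum_i a i ^+ 2) * Num.sqrt (\sum_i b i ^+ 2).
Proof.
set A := Num.sqrt _; set B := Num.sqrt (\sum_i b i ^+ 2).
have a0 : 0 <= \sum_i a i ^+ 2 by apply: sumr_ge0 => i _; exact: sqr_ge0.
have b0 : 0 <= \sum_i b i ^+ 2 by apply: sumr_ge0 => i _; exact: sqr_ge0.
have AE : A ^+ 2 = \sum_i a i ^+ 2 by rewrite sqr_sqrtr.
have BE : B ^+ 2 = \sum_i b i ^+ 2 by rewrite sqr_sqrtr.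
have A0 : 0 <= A by exact: sqrtr_ge0.
have B0 : 0 <= B by exact: sqrtr_ge0.
have H : A * B * 2 * (\sum_i a i * b i) <= A * B * 2 * (A * B).
  have : 0 <= \sum_i (B * a i - A * b i) ^+ 2 by apply: sumr_ge0 => i _; exact: sqr_ge0.
  rewrite (eq_bigr (fun i => B ^+ 2 * a i ^+ 2 + A ^+ 2 * b i ^+ 2 -
      A * B * 2 * (a i * b i))); last first.
    by move=> i _; ring.
  rewrite big_split big_split /= sumrN -!mulr_sumr -AE -BE subr_ge0 => /le_trans; apply.
  by rewrite le_eqVlt; apply/orP; left; apply/eqP; ring.
have [AB0|AB0] := eqVneq (A * B) 0; last first.
  by rewrite -(ler_pM2l (x := A * B * 2)) // mulr_gt0// lt_neqAle eq_sym AB0 mulr_ge0.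
rewrite AB0.
suff -> : \sum_i a i * b i = 0 by rewrite lexx.
have null (c : 'I_n -> R) (C : R) : C = 0 -> C ^+ 2 = \sum_i c i ^+ 2 -> forall i, c i = 0.
  move=> -> /esym; rewrite expr0n /= => /eqP; rewrite psumr_eq0 => [|i _]; last exact: sqr_ge0.
  by move=> /allP c0 i; apply/eqP; rewrite -sqrf_eq0; exact: (c0 i (mem_index_enum _)).
move/eqP: AB0; rewrite mulf_eq0 => /orP[] /eqP C0; apply: big1 => i _.
  by rewrite (null a A)// mul0r.
by rewrite (null b B)// mulr0.
Qed.

Variable n : nat.
Implicit Types x y z : Rn R n.

Lemma eucl_dist_ge0 x y : 0 <= eucl_dist x y.
Proof. exact: sqrtr_ge0. Qed.

Lemma eucl_distC x y : eucl_dist x y = eucl_dist y x.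
Proof.
by rewrite /eucl_dist; congr Num.sqrt; apply: eq_bigr => i _; rewrite -sqrrN opprB.
Qed.

Lemma eucl_distxx x : eucl_dist x x = 0.
Proof.
by rewrite /eucl_dist big1 ?sqrtr0// => i _; rewrite subrr expr0n.
Qed.

Lemma eucl_dist_triangle y x z : eucl_dist x z <= eucl_dist x y + eucl_dist y z.
Proof.
have s0 u v : 0 <= \sum_(i < n) (tnth u i - tnth v i : R) ^+ 2.
  by apply: sumr_ge0 => i _; exact: sqr_ge0.
rewrite -(ler_pXn2r (n := 2))//; last 2 first.
- by rewrite nnegrE eucl_dist_ge0.
- by rewrite nnegrE addr_ge0 ?eucl_dist_ge0.
rewrite sqrrD {1 2 4}/eucl_dist !sqr_sqrtr//.
have := sum_sqr_cauchy_schwarz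
  (fun i => tnth x i - tnth y i : R) (fun i => tnth y i - tnth z i : R).
rewrite -/(eucl_dist x y) -/(eucl_dist y z) => CS.
rewrite [leLHS](_ : _ = \sum_(i < n) (tnth x i - tnth y i : R) ^+ 2 +
   (\sum_(i < n) (tnth x i - tnth y i : R) * (tnth y i - tnth z i)) *+ 2 +
   \sum_(i < n) (tnth y i - tnth z i : R) ^+ 2); last first.
  rewrite -sumrMnl -!big_split /=; apply: eq_bigr => i _.
  by rewrite -sqrrD; congr (_ ^+ 2); rewrite addrA subrK.
by rewrite lerD2r lerD2l lerMn2r.
Qed.

Lemma eucl_dist_coord x y i : `|tnth x i - tnth y i : R| <= eucl_dist x y.
Proof.
rewrite -sqrtr_sqr /eucl_dist ler_sqrt; last by apply: sumr_ge0 => j _; exact: sqr_ge0.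
rewrite (bigD1 i)//= lerDl; apply: sumr_ge0 => j _; exact: sqr_ge0.
Qed.

(** A cube of side 2r/n sits inside the ball of radius r. The optimal side is
    2r/sqrt n; dividing by n avoids the square root. *)
Lemma eucl_dist_lt_coord x y (r : R) : (0 < n)%N -> 0 < r ->
  (forall i, `|tnth x i - tnth y i : R| < r / n%:R) -> eucl_dist x y < r.
Proof.
move=> n0 r0 xy; have n0' : 0 < n%:R :> R by rewrite ltr0n.
rewrite -(ltr_pXn2r (n := 2))// ?nnegrE ?eucl_dist_ge0 ?(ltW r0)//.
rewrite sqr_sqrtr; last by apply: sumr_ge0 => i _; exact: sqr_ge0.
apply: (@lt_le_trans _ _ (\sum_(i < n) (r / n%:R) ^+ 2)).
  have xy2 i : (tnth x i - tnth y i : R) ^+ 2 < (r / n%:R) ^+ 2.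
    rewrite -real_normK ?num_real// ltr_pXn2r// nnegrE// divr_ge0// ?ltW//.
  have i0 : 'I_n by case: (n) n0 => // m _; exact: ord0.
  rewrite (bigD1 i0)//= [ltRHS](bigD1 i0)//= ltr_leD//.
  by apply: ler_sum => i _; exact/ltW.
rewrite sumr_const card_ord -mulr_natr.
rewrite [leLHS](_ : _ = r ^+ 2 / n%:R); last by field; rewrite gt_eqF.
by rewrite ler_pdivrMr// ler_peMr ?sqr_ge0// ler1n.
Qed.

Lemma measurable_eucl_dist x : measurable_fun setT (fun y => eucl_dist y x).
Proof.
rewrite /eucl_dist.
apply: (@measurableT_comp _ _ _ _ _ _ (@Num.sqrt R)).
  by apply: continuous_measurable_fun; exact: sqrt_continuous.
apply: measurable_sum => i; apply: measurable_funX.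
by apply: measurable_funB => //; exact: measurable_tnth.
Qed.

Lemma measurable_eucl_ball x (r : R) : measurable (eucl_ball x r).
Proof.
rewrite (_ : eucl_ball x r = (fun y => eucl_dist y x) @^-1` `]-oo, r[).
  by rewrite -[X in measurable X]setTI; apply: measurable_eucl_dist.
by apply/seteqP; split => y /=; rewrite in_itv.
Qed.

End euclidean_space.

Section ball_measure.
Context (R : realType).

Definition cube (n : nat) (x : Rn R n) (r : R) : set (Rn R n) :=
  [set y | forall i, `|tnth y i - tnth x i : R| < r].

Lemma cube_cons (n : nat) (x : Rn R n.+1) (r : R) :
  @cons_pair R n @^-1` cube x r =
  cube (uncons_pair x).1 r `*` [set` `](thead x : R) - r, (thead x : R) + r[].
Proof.
have xS j : tnth x (lift ord0 j) = tnth (uncons_pair x).1 j.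
  by rewrite {1}(tuple_eta x) tnthS.
have yS (y : Rn R n) a j : tnth (cons_pair (y, a)) (lift ord0 j) = tnth y j.
  exact: tnthS.
have y0 (y : Rn R n) a : tnth (cons_pair (y, a)) ord0 = a by exact: tnth0.
have itvE (a : R) : (`|a - thead x| < r) = (a \in `](thead x : R) - r, (thead x : R) + r[).
  by rewrite in_itv/= ltr_norml ltrBlDr ltrBrDr addrC [r + _]addrC.
apply/seteqP; split => -[y a] /=.
  move=> H; split => [i|] /=; first by have := H (lift ord0 i); rewrite xS yS.
  by have := H ord0; rewrite y0 itvE.
move=> [H1 H2] i; case: (unliftP ord0 i) => [j ->|->].
  by rewrite xS yS; exact: H1.
by rewrite y0 itvE.
Qed.

Lemma lebesgue_cube (n : nat) (x : Rn R n) (r : R) : 0 < r ->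
  measurable (cube x r) /\ lebesgue_rn R n (cube x r) = ((2 * r) ^+ n)%:E.
Proof.
move=> r0; elim: n x => [x|n IH x].
  have -> : cube x r = setT by apply/seteqP; split => // y _ [].
  by split => //=; rewrite diracT.
have [mc mE] := IH (uncons_pair x).1.
split.
  rewrite (_ : cube x r = @uncons_pair R n @^-1` (@cons_pair R n @^-1` cube x r)).
    rewrite -[X in measurable X]setTI; apply: measurable_uncons_pair => //.
    by rewrite cube_cons; exact: measurableX.
  rewrite -comp_preimage (_ : _ \o _ = id) ?preimage_id//.
  by apply/funext => y /=; rewrite [RHS]tuple_eta; apply: val_inj.
rewrite /= /lebesgue_succ /pushforward cube_cons.
set I := [set` _ ].
transitivity (lebesgue_rn R n (cube (uncons_pair x).1 r) * lebesgue_measure I)%E.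
  by rewrite product_measure1E; [exact: erefl|exact: mc|exact: measurable_itv].
rewrite mE /I lebesgue_measure_itv/= lte_fin.
rewrite ltrD2l gtrN// -EFinB -EFinM exprSr; congr (_ * _)%:E.
by ring.
Qed.

(** The ball lies between two concentric cubes. All the size estimates below
    use only this comparison of the measure of a ball with r^n, uniform in the
    centre. *)
Lemma lebesgue_ball_bounds (n : nat) (x : Rn R n) (r : R) : (0 < n)%N -> 0 < r ->
  (((2 / n%:R) ^+ n * r ^+ n)%:E <= lebesgue_rn R n (eucl_ball x r) <=
   (2 ^+ n * r ^+ n)%:E)%E.
Proof.
move=> n0 r0; have n0' : 0 < n%:R :> R by rewrite ltr0n.
have [m1 E1] := lebesgue_cube x (divr_gt0 r0 n0').
have [m2 E2] := lebesgue_cube x r0.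
have mB := measurable_eucl_ball x r.
rewrite -!exprMn -E2 mulrAC -mulrA -E1; apply/andP; split.
  apply: le_measure; rewrite ?inE//.
  by move=> y /= xy; exact: eucl_dist_lt_coord.
apply: le_measure; rewrite ?inE//.
by move=> y /= xy i; exact: le_lt_trans (eucl_dist_coord _ _ _) xy.
Qed.

End ball_measure.

(** * Rational balls and the weighted weak type inequality *)

Lemma seq_argmax (R : realType) (I : eqType) (f : I -> R) (s : seq I) i0 :
  i0 \in s -> exists2 b, b \in s & forall i, i \in s -> f i <= f b.
Proof.
elim: s i0 => // i s IHs _ _; case: s IHs => [_|j s IHs].
  by exists i; rewrite ?mem_head// => k; rewrite inE => /eqP ->.
have [b bs bmax] := IHs j (mem_head _ _).
have [ib|bi] := leP (f i) (f b).
  exists b; first by rewrite inE bs orbT.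
  by move=> k; rewrite inE => /orP[/eqP ->//|]; exact: bmax.
exists i; first by rewrite mem_head.
move=> k; rewrite inE => /orP[/eqP ->//|/bmax kb].
exact: le_trans kb (ltW bi).
Qed.

Section rational_balls.
Context (R : realType) (n : nat).
Hypothesis n_gt0 : (0 < n)%N.
Implicit Types (x y : Rn R n).

(** Balls with rational data form a countable family, so unions of them are
    measurable and are exhausted by finite unions. This replaces compactness in
    the covering arguments. *)
Definition rational_point (c : n.-tuple rat) : Rn R n :=
  [tuple (ratr (tnth c i) : measurableTypeR R) | i < n].

Definition rational_ball (i : n.-tuple rat * rat) : set (Rn R n) :=
  eucl_ball (rational_point i.1) (ratr i.2).

Lemma rational_point_dense x (e : R) : 0 < e ->
  exists c, eucl_dist (rational_point c) x < e.
Proof.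
move=> e0.
have /choice[c cP] : forall i, exists q : rat, `|ratr q - (tnth x i : R)| < e / n%:R.
  move=> i; have [|q] := @rat_in_itvoo R ((tnth x i : R) - e / n%:R) ((tnth x i : R) + e / n%:R).
    by rewrite ltrD2l gtrN// divr_gt0// ltr0n.
  by rewrite in_itv/= => /andP[q1 q2]; exists q; rewrite ltr_distl q1 q2.
exists [tuple c i | i < n]; apply: eucl_dist_lt_coord => // i.
by rewrite /rational_point !tnth_mktuple.
Qed.

(** Passing to a rational ball costs at most a factor 3 in the radius. *)
Lemma rational_ball_cover y (r : R) : 0 < r -> exists i,
  [/\ eucl_ball y r `<=` rational_ball i, 0 < ratr i.2 :> R & ratr i.2 < 3 * r].
Proof.
move=> r0; have [c cy] := rational_point_dense y r0.
have [|q] := @rat_in_itvoo R (2 * r) (3 * r); first by rewrite ltr_pM2r// ltr_nat.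
rewrite in_itv/= => /andP[q1 q2]; exists (c, q); split => //=.
  move=> z /= zy; rewrite /rational_ball/=; apply: lt_trans q1.
  rewrite mulr_natl mulr2n.
  apply: le_lt_trans (eucl_dist_triangle y _ _) _.
  by rewrite ltrD// eucl_distC.
by apply: lt_trans q1; rewrite mulr_gt0.
Qed.

Lemma rational_ball_inside y (r : R) : 0 < r -> exists i,
  rational_ball i y /\ rational_ball i `<=` eucl_ball y r.
Proof.
move=> r0; have r3 : 0 < r / 3 by rewrite divr_gt0.
have [c cy] := rational_point_dense y r3.
have [|q] := @rat_in_itvoo R (r / 3) (r / 2).
  by rewrite ltr_pM2l// ltf_pV2 ?posrE// ltr_nat.
rewrite in_itv/= => /andP[q1 q2]; exists (c, q); rewrite /rational_ball /=; split => [|z /= zc].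
  by rewrite /eucl_ball/= eucl_distC; apply: lt_trans q1.
apply: le_lt_trans (eucl_dist_triangle (rational_point c) _ _) _.
apply: lt_le_trans (ltrD zc cy) _; lra.
Qed.

Lemma measurable_rational_ball i : measurable (rational_ball i).
Proof. exact: measurable_eucl_ball. Qed.

Lemma measurable_bigcup_rational_ball (P : set (n.-tuple rat * rat)) :
  measurable (\bigcup_(i in P) rational_ball i).
Proof.
rewrite bigcup_mkcond; apply: countable_bigcupT_measurable => [|i].
  exact: countableP.
by case: ifP => // _; exact: measurable_rational_ball.
Qed.

Lemma measurable_eucl_open (U : set (Rn R n)) :
  (forall x, U x -> exists2 r : R, 0 < r & eucl_ball x r `<=` U) ->
  measurable U.
Proof.
move=> Uo; rewrite (_ : U = \bigcup_(i in [set i | rational_ball i `<=` U]) rational_ball i).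
  exact: measurable_bigcup_rational_ball.
apply/seteqP; split => [x Ux|x [i iU ix]]; last exact: iU.
have [r r0 rU] := Uo _ Ux; have [i [ix ir]] := rational_ball_inside x r0.
by exists i => //=; exact: subset_trans rU.
Qed.

Lemma lower_semicontinuous_measurable (f : Rn R n -> \bar R) :
  (forall (a : R) x, (a%:E < f x)%E ->
     exists2 r : R, 0 < r & forall y, eucl_dist y x < r -> (a%:E < f y)%E) ->
  measurable_fun setT f.
Proof.
move=> fl; apply: (measurability (@ErealGenOInfty.G R)).
  exact: ErealGenOInfty.measurableE.
move=> _ [_ [a ->] <-]; rewrite setTI; apply: measurable_eucl_open => x /=.
rewrite in_itv/= andbT => /fl[r r0 rf]; exists r => // y /rf /=.
by rewrite in_itv/= andbT.
Qed.

End rational_balls.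

Section hardy_littlewood.
Context (R : realType) (n : nat).
Hypothesis n_gt0 : (0 < n)%N.
Variables (mu : {measure set (Rn R n) -> \bar R}) (c1 c2 : R).
Hypothesis c1_gt0 : 0 < c1.
Hypothesis mu_ball : forall x (r : R), 0 < r ->
  ((c1 * r ^+ n)%:E <= mu (eucl_ball x r) <= (c2 * r ^+ n)%:E)%E.
Local Open Scope ereal_scope.
Implicit Types (h : Rn R n -> R) (lam : R).

Let c2_gt0 : (0 < c2)%R.
Proof.
have /andP[h1 h2] := @mu_ball [tuple 0%R | i < n] 1 ltr01.
have := le_trans h1 h2; rewrite !expr1n !mulr1 lee_fin; exact: lt_le_trans.
Qed.

(** The Hardy-Littlewood maximal function M h enters only through its
    superlevel sets: [hl_level h lam] is the set where the average of h over
    some rational ball containing the point exceeds lam. *)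
Definition hl_index h lam : set (n.-tuple rat * rat) :=
  [set i | lam%:E * mu (@rational_ball R n i) <
           \int[mu]_(x in @rational_ball R n i) (h x)%:E].

Definition hl_level h lam : set (Rn R n) :=
  \bigcup_(i in hl_index h lam) @rational_ball R n i.

Lemma measurable_hl_level h lam : measurable (hl_level h lam).
Proof. exact: measurable_bigcup_rational_ball. Qed.

Lemma mu_eucl_ball_lty x (r : R) : (0 < r)%R -> mu (eucl_ball x r) < +oo.
Proof. by move=> r0; have /andP[_ /le_lt_trans ->] := mu_ball x r0; rewrite ?ltry. Qed.

Lemma eucl_ball0 (x : Rn R n) (r : R) : (r <= 0)%R -> eucl_ball x r = set0.
Proof.
move=> r0; apply/seteqP; split => // y /= yr.
by have := lt_le_trans yr r0; rewrite ltNge eucl_dist_ge0.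
Qed.

Lemma hl_index_gt0 h lam i : hl_index h lam i -> (0 < ratr i.2 :> R)%R.
Proof.
rewrite /hl_index/= => hi; rewrite ltNge; apply/negP => i0; move: hi.
by rewrite /rational_ball eucl_ball0// measure0 mule0 integral_set0 ltxx.
Qed.

(** The part of [h] below lam/2 contributes at most lam/2 to an average. So only
    the large values of [h] matter at height lam, which is the source of the
    gain when levels are summed. *)
Lemma hl_level_truncate h lam : measurable_fun setT h -> (forall x, 0 <= h x)%R ->
  (0 < lam)%R ->
  hl_level h lam `<=`
  hl_level (fun x => h x * (lam / 2 < h x)%R%:R)%R (lam / 2).
Proof.
move=> mh h0 lam0 x [i Pi ix]; exists i => //.
have i0 := hl_index_gt0 Pi.
move: Pi; rewrite /hl_index /=; set B := rational_ball i => Pi.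
have mB : measurable B by exact: measurable_rational_ball.
have Boo : mu B < +oo by exact: mu_eucl_ball_lty.
rewrite ltNge; apply/negP => hle; move: Pi; apply/negP; rewrite -leNgt.
pose h1 := (fun x => h x * (lam / 2 < h x)%R%:R)%R.
have mh1 : measurable_fun setT h1.
  apply: measurable_funM => //.
  apply: (measurableT_comp (f := fun b : bool => b%:R : R)) => //.
  exact: measurable_fun_ltr.
apply: (@le_trans _ _ (\int[mu]_(x in B) ((h1 x)%:E + (lam / 2)%:E))).
  apply: ge0_le_lower_integral => y _; rewrite ?lee_fin//.
  - by rewrite addr_ge0 ?mulr_ge0// ?divr_ge0// ltW.
  - rewrite /h1; case: ltP => //= hy; first by rewrite mulr1 lerDl divr_ge0// ltW.
    by rewrite mulr0 add0r.
rewrite ge0_integralD//; last 3 first.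
- by move=> y _; rewrite lee_fin mulr_ge0.
- by apply/measurable_EFinP; exact: measurable_funTS.
- by move=> y _; rewrite lee_fin divr_ge0// ltW.
rewrite integral_cst//; apply: le_trans (leeD2r _ hle) _.
by rewrite -ge0_muleDl ?lee_fin ?divr_ge0 ?(ltW lam0)// -EFinD -splitr.
Qed.

(* [weight] is the A_q condition in the form in which it is applied: on a ball
   where the average of [h] exceeds lam, the weight of the ball is controlled by
   lam^-q times the weighted integral of h^q. *)
Variables (w : Rn R n -> R) (q A : R).
Hypothesis w_ge0 : forall x, (0 <= w x)%R.
Hypothesis mw : measurable_fun setT w.
Hypothesis q_gt0 : (0 < q)%R.
Hypothesis A_ge0 : (0 <= A)%R.
Hypothesis weight : forall x (r : R) h lam, (0 < r)%R ->
  measurable_fun setT h -> (forall y, 0 <= h y)%R -> (0 < lam)%R ->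
  lam%:E * mu (eucl_ball x r) < \int[mu]_(y in eucl_ball x r) (h y)%:E ->
  (lam `^ q)%:E * \int[mu]_(y in eucl_ball x r) (w y)%:E <=
    A%:E * \int[mu]_(y in eucl_ball x r) (h y `^ q * w y)%:E.

Let ratio := (3 ^+ n * c2 / c1)%R.

Let ratio_gt0 : (0 < ratio)%R.
Proof. by rewrite /ratio divr_gt0// mulr_gt0// exprn_gt0. Qed.

(** The A_q condition on the tripled ball, tested on [h] restricted to the
    small ball; it contains the doubling property of the weight. *)
Lemma weight_triple_ball x (r : R) h lam : (0 < r)%R ->
  measurable_fun setT h -> (forall y, 0 <= h y)%R -> (0 < lam)%R ->
  lam%:E * mu (eucl_ball x r) < \int[mu]_(y in eucl_ball x r) (h y)%:E ->
  \int[mu]_(y in eucl_ball x (3 * r)) (w y)%:E <=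
    (A * (ratio / lam) `^ q)%:E *
    \int[mu]_(y in eucl_ball x r) (h y `^ q * w y)%:E.
Proof.
move=> r0 mh h0 lam0 hB; have r3 : (0 < 3 * r)%R by rewrite mulr_gt0.
have sub3 : eucl_ball x r `<=` eucl_ball x (3 * r).
  by move=> y /= /lt_le_trans; apply; rewrite ler_peMl ?ltW// ltr1n.
pose h' := (h \_ (eucl_ball x r))%R.
have mB := measurable_eucl_ball x r.
have mh' : measurable_fun setT h'.
  by apply/(measurable_restrictT _ _).1 => //; exact: measurable_funTS.
have h'0 y : (0 <= h' y)%R by rewrite /= /h' patchE; case: ifP.
have restr (f : Rn R n -> R) (g : Rn R n -> R) :
    (forall y, eucl_ball x r y -> g y = f y) -> (forall y, ~ eucl_ball x r y -> g y = 0%R) ->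
    \int[mu]_(y in eucl_ball x (3 * r)) (g y)%:E =
    \int[mu]_(y in eucl_ball x r) (f y)%:E.
  move=> gf g0; rewrite integral_mkcond [RHS]integral_mkcond.
  apply: eq_integral => y _; rewrite !patchE.
  have [By|By] := pselect (eucl_ball x r y).
    by rewrite !mem_set//= ?gf//; exact: sub3.
  by rewrite (memNset By) g0//; case: ifP.
have hB3 : (lam / ratio)%:E * mu (eucl_ball x (3 * r)) <
    \int[mu]_(y in eucl_ball x (3 * r)) (h' y)%:E.
  rewrite (restr h); last 2 first.
  - by move=> y By; rewrite /= /h' patchE mem_set.
  - by move=> y By; rewrite /= /h' patchE memNset.
  apply: le_lt_trans hB.
  have /andP[l1 _] := mu_ball x r0; have /andP[_ l2] := mu_ball x r3.
  apply: (@le_trans _ _ ((lam / ratio)%:E * (c2 * (3 * r) ^+ n)%:E)).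
    by rewrite lee_pmul2l// lte_fin divr_gt0.
  apply: (@le_trans _ _ (lam%:E * (c1 * r ^+ n)%:E)); last by rewrite lee_pmul2l.
  rewrite -!EFinM lee_fin /ratio exprMn le_eqVlt; apply/orP; left; apply/eqP.
  field; rewrite !gt_eqF//= ?exprn_gt0//.
have := weight r3 mh' h'0 (divr_gt0 lam0 ratio_gt0) hB3.
rewrite (restr (fun y => h y `^ q * w y)%R (fun y => h' y `^ q * w y)%R); last 2 first.
- by move=> y By; rewrite /= /h' patchE mem_set.
- by move=> y By; rewrite /= /h' patchE memNset// powR0 ?mul0r// gt_eqF.
move=> H.
have l0 : (0 < (lam / ratio) `^ q)%R by rewrite powR_gt0// divr_gt0.
rewrite -(@lee_pmul2l _ ((lam / ratio) `^ q)%:E)//; apply: le_trans H _.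
rewrite muleA -EFinM mulrCA -powRM; last 2 first.
- exact/ltW/divr_gt0.
- exact/ltW/divr_gt0.
rewrite (_ : (lam / ratio * (ratio / lam))%R = 1%R) ?powR1 ?mulr1//.
by field; rewrite !gt_eqF.
Qed.

Let K lam := (A * (ratio / lam) `^ q)%R.

Let mhw h : measurable_fun setT h -> measurable_fun setT (fun y => (h y `^ q * w y)%:E).
Proof.
move=> mh; apply/measurable_EFinP; apply: measurable_funM => //.
by apply: (measurableT_comp (f := fun x : R => (x `^ q)%R)) => //; exact: measurable_powR.
Qed.

Let hw0 h y : 0 <= (h y `^ q * w y)%:E.
Proof. by rewrite lee_fin mulr_ge0// powR_ge0. Qed.

(** Vitali's selection run as an induction: the triple of the largest ball of
    the family covers all the balls that it meets, and the balls that it does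
    not meet form a smaller family, whose contribution to the right-hand side
    is disjoint from that of the largest ball. *)
Lemma weak_type_finite h lam (s : seq (n.-tuple rat * rat)) :
  measurable_fun setT h -> (forall y, 0 <= h y)%R -> (0 < lam)%R ->
  (forall i, i \in s -> hl_index h lam i) ->
  \int[mu]_(y in \bigcup_(i in [set` s]) @rational_ball R n i) (w y)%:E <=
    (K lam)%:E *
    \int[mu]_(y in \bigcup_(i in [set` s]) @rational_ball R n i) (h y `^ q * w y)%:E.
Proof.
move=> mh h0 lam0; have [m] := ubnP (size s); elim: m s => // m IH [|i0 s0] sm sP.
  by rewrite set_nil bigcup_set0 !integral_set0 mule0.
set s := i0 :: s0 in sm sP *.
have i0s : i0 \in s by rewrite mem_head.
have [b bs bmax] := seq_argmax (fun i => ratr i.2 : R) i0s.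
pose B := @rational_ball R n b.
pose s1 := [seq i <- s | `[< @rational_ball R n i `&` B = set0 >]].
have b0 : (0 < ratr b.2 :> R)%R by exact: hl_index_gt0 (sP _ bs).
have Bne : B (rational_point R b.1) by rewrite /B /rational_ball /eucl_ball/= eucl_distxx.
have s1s : {subset s1 <= s} by move=> i; rewrite mem_filter => /andP[].
have bs1 : b \notin s1.
  rewrite mem_filter negb_and; apply/orP; left; apply/asboolPn; rewrite setIid => /seteqP[+ _].
  by move=> /(_ _ Bne).
have s1m : (size s1 < m)%N.
  rewrite -ltnS; apply: leq_trans sm; rewrite ltnS.
  have := count_size (fun i => `[< @rational_ball R n i `&` B = set0 >]) s.
  rewrite size_filter leq_eqVlt => /orP[/eqP ce|]//.
  have := bs1; rewrite mem_filter bs andbT => /negP[].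
  have := all_count (fun i => `[< @rational_ball R n i `&` B = set0 >]) s.
  by rewrite ce eqxx => /allP /(_ _ bs).
pose U1 := \bigcup_(i in [set` s1]) @rational_ball R n i.
pose U := \bigcup_(i in [set` s]) @rational_ball R n i.
have mU1 : measurable U1 by exact: measurable_bigcup_rational_ball.
have mU : measurable U by exact: measurable_bigcup_rational_ball.
have mB : measurable B by exact: measurable_rational_ball.
pose B3 := eucl_ball (rational_point R b.1) (3 * ratr b.2).
have mB3 : measurable B3 by exact: measurable_eucl_ball.
have UE : U `<=` B3 `|` U1.
  move=> y [i /= si iy].
  have [iB|iB] := pselect (@rational_ball R n i `&` B = set0).
    by right; exists i => //=; rewrite mem_filter si andbT; exact/asboolP.
  left; have /set0P[z [iz bz]] : @rational_ball R n i `&` B != set0 by exact/eqP.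
  rewrite /B3 /eucl_ball /=.
  apply: le_lt_trans (eucl_dist_triangle (rational_point R i.1) _ _) _.
  apply: le_lt_trans (lerD (lexx _) (eucl_dist_triangle z _ _)) _.
  rewrite /rational_ball /eucl_ball /= in iy iz; rewrite /B /rational_ball /eucl_ball /= in bz.
  have := bmax _ si; rewrite eucl_distC in iz => ib.
  by lra.
have wint D : measurable_fun D (fun y => (w y)%:E).
  by apply/measurable_EFinP; exact: measurable_funTS.
have hint D : measurable_fun D (fun y => (h y `^ q * w y)%:E).
  by apply: measurable_funTS; exact: mhw.
apply: (@le_trans _ _ (\int[mu]_(y in B3) (w y)%:E + \int[mu]_(y in U1) (w y)%:E)).
  rewrite -/U.
  rewrite [leLHS]integral_mkcond [X in _ <= X + _]integral_mkcond [X in _ <= _ + X]integral_mkcond.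
  rewrite -ge0_integralD//; last 4 first.
  - by move=> y _; apply: erestrict_ge0 => z _; rewrite lee_fin.
  - by apply/(measurable_restrictT _ _).1.
  - by move=> y _; apply: erestrict_ge0 => z _; rewrite lee_fin.
  - by apply/(measurable_restrictT _ _).1.
  apply: ge0_le_lower_integral => y _; rewrite ?adde_ge0//;
    try by apply: erestrict_ge0 => z _; rewrite lee_fin.
  rewrite !patchE; case: (boolP (y \in U)) => [/set_mem /UE [] Uy|_].
  - by rewrite (mem_set Uy); case: ifP => _; rewrite ?adde0// leeDl// lee_fin.
  - by rewrite (mem_set Uy); case: ifP => _; rewrite ?add0e// leeDl// lee_fin.
  - by case: ifP => _; case: ifP => _; rewrite ?adde_ge0 ?lee_fin.
apply: (@le_trans _ _ ((K lam)%:E * \int[mu]_(y in B) (h y `^ q * w y)%:E +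
    (K lam)%:E * \int[mu]_(y in U1) (h y `^ q * w y)%:E)).
  apply: leeD.
    apply: weight_triple_ball => //; exact: (sP _ bs).
  by apply: IH => // i /s1s; exact: sP.
rewrite -ge0_muleDr; try by apply: integral_ge0.
rewrite -ge0_integral_setU//; last first.
  rewrite disj_set2E; apply/eqP; apply/seteqP; split => // y [By [i si iy]]; move: si => /=.
  rewrite mem_filter => /andP[/asboolP iB _].
  by suff : (@rational_ball R n i `&` B) y by rewrite iB.
apply: lee_pmul => //; first by rewrite lee_fin mulr_ge0 ?powR_ge0.
  by apply: integral_ge0.
apply: ge0_subset_integral => //; first exact: measurableU.
rewrite -/U => y [By|[i /= /s1s si iy]]; first by exists b.
by exists i.
Qed.

(** The weak type (q,q) inequality: let finite families of rational balls
    exhaust the superlevel set. *)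
Lemma weak_type h lam :
  measurable_fun setT h -> (forall y, 0 <= h y)%R -> (0 < lam)%R ->
  \int[mu]_(y in hl_level h lam) (w y)%:E <=
    (A * (ratio / lam) `^ q)%:E * \int[mu]_y (h y `^ q * w y)%:E.
Proof.
move=> mh h0 lam0.
pose s m := [seq i <- pmap (@unpickle (n.-tuple rat * rat)%type) (iota 0 m) |
               `[< hl_index h lam i >]].
pose F m := \bigcup_(i in [set` s m]) @rational_ball R n i.
have mF m : measurable (F m) by exact: measurable_bigcup_rational_ball.
have sS m1 m2 : (m1 <= m2)%N -> {subset s m1 <= s m2}.
  move=> m12 i; rewrite !mem_filter => /andP[-> /=]; rewrite !mem_pmap.
  move=> /mapP[k]; rewrite mem_iota => /andP[_ km] ->; apply: map_f.
  by rewrite mem_iota /= (leq_trans km).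
have Fnd : nondecreasing_seq F.
  move=> m1 m2 m12; apply/subsetPset => y [i /= si iy]; exists i => //=.
  exact: sS si.
have FE : hl_level h lam = \bigcup_m F m.
  apply/seteqP; split => [y [i Pi iy]|y [m _ [i /= si iy]]].
    exists (pickle i).+1 => //; exists i => //=.
    rewrite mem_filter; apply/andP; split; first exact/asboolP.
    rewrite mem_pmap -(pickleK i); apply: map_f.
    by rewrite mem_iota /= ltnS.
  by exists i => //; move: si; rewrite mem_filter => /andP[/asboolP].
have wint D : measurable_fun D (fun y => (w y)%:E).
  by apply/measurable_EFinP; exact: measurable_funTS.
rewrite FE; have cv := @ge0_nondecreasing_set_cvg_integral _ _ _ F (fun y => (w y)%:E) mu Fnd mF
  (fun=> wint _) (fun _ y _ => w_ge0 y).
rewrite -(cvg_lim _ cv)//; apply: lime_le; first by apply/cvg_ex; eexists; exact: cv.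
apply: nearW => m; apply: le_trans (weak_type_finite mh h0 lam0 _) _.
  by move=> i; rewrite mem_filter => /andP[/asboolP].
apply: lee_pmul => //; first by rewrite lee_fin mulr_ge0 ?powR_ge0.
  by apply: integral_ge0.
apply: ge0_subset_integral => //; first exact: (mF m).
exact: mhw.
Qed.

End hardy_littlewood.

(** * Muckenhoupt weights *)

Section weighted_hoelder.
Context d (T : measurableType d) (R : realType).
Variable mu : {measure set T -> \bar R}.
Local Open Scope ereal_scope.

Lemma ae_exists (B : set T) (P : T -> Prop) :
  measurable B -> 0 < mu B -> (\forall x \ae mu, P x) -> exists2 x, B x & P x.
Proof.
move=> mB B0 [N [mN N0 PN]]; apply: contrapT => nP.
move: B0; rewrite lt0e => /andP[/eqP + _]; apply.
apply: (subset_measure0 mB mN _ N0) => x Bx; apply: PN => /= Px; apply: nP.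
by exists x.
Qed.

(** Hoelder's inequality for h = (h w^(1/q)) w^(-1/q). *)
Lemma weighted_hoelder (B : set T) (h w : T -> R) (q : R) :
  measurable B -> measurable_fun setT h -> measurable_fun setT w ->
  (forall x, 0 <= h x)%R -> (forall x, 0 < w x)%R -> (1 < q)%R ->
  (\int[mu]_(x in B) (h x)%:E) `^ q <=
  (\int[mu]_(x in B) (h x `^ q * w x)%:E) *
  (\int[mu]_(x in B) (w x `^ (- (q - 1)^-1))%:E) `^ (q - 1).
Proof.
move=> mB mh mw h0 w0 q1.
have q0 : (0 < q)%R by exact: lt_trans q1.
have q1' : (0 < q - 1)%R by rewrite subr_gt0.
pose q' := (q / (q - 1))%R.
have q'0 : (0 < q')%R by rewrite divr_gt0.
have mpow (s : R) : measurable_fun setT (fun x => w x `^ s)%R.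
  by apply: (measurableT_comp (f := fun x : R => (x `^ s)%R)) => //; exact: measurable_powR.
pose f := ((fun x => h x * w x `^ q^-1)%R \_ B)%R.
pose g := ((fun x => w x `^ (- q^-1))%R \_ B)%R.
have mf : measurable_fun setT f.
  apply/(measurable_restrictT _ _).1 => //; apply: measurable_funTS.
  exact: measurable_funM.
have mg : measurable_fun setT g.
  by apply/(measurable_restrictT _ _).1 => //; apply: measurable_funTS.
have qq' : (q^-1 + q'^-1 = 1)%R.
  by rewrite /q'; field; rewrite !gt_eqF.
have := hoelder mu mf mg q0 q'0 qq'.
rewrite Lnorm1 => H.
have -> : \int[mu]_(x in B) (h x)%:E = \int[mu]_x `|(EFin \o (f \* g)%R) x|.
  rewrite integral_mkcond; apply: eq_integral => x _ /=.
  rewrite /f /g !patchE; case: ifPn => // xB; last by rewrite mulr0 normr0.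
  rewrite -mulrA -powRD ?subrr ?powRr0 ?mulr1 ?ger0_norm//.
  by apply/implyP => _; rewrite gt_eqF.
have normf : 'N[mu]_q%:E [EFin \o f] = (\int[mu]_(x in B) (h x `^ q * w x)%:E) `^ q^-1.
  rewrite unlock; congr (_ `^ _); rewrite [RHS]integral_mkcond.
  apply: eq_integral => x _ /=; rewrite /f !patchE.
  case: ifPn => // xB; last by rewrite normr0 powR0// gt_eqF.
  rewrite ger0_norm ?mulr_ge0 ?powR_ge0// powRM ?powR_ge0//.
  by rewrite -powRrM mulVf ?gt_eqF// powRr1// ltW.
have normg : 'N[mu]_q'%:E [EFin \o g] = (\int[mu]_(x in B) (w x `^ (- (q - 1)^-1))%:E) `^ q'^-1.
  rewrite unlock; congr (_ `^ _); rewrite [RHS]integral_mkcond.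
  apply: eq_integral => x _ /=; rewrite /g !patchE.
  case: ifPn => // xB; last by rewrite normr0 powR0// gt_eqF.
  rewrite ger0_norm ?powR_ge0// -powRrM; congr (_ `^ _)%:E.
  by rewrite /q'; field; rewrite !gt_eqF.
rewrite normf normg in H.
have := gt0_ler_poweR (ltW q0) _ _ H.
set X := \int[mu]_(x in B) (h x `^ q * w x)%:E.
set V := \int[mu]_(x in B) (w x `^ _)%:E.
rewrite poweRM ?poweR_ge0// -!poweRrM mulVf ?gt_eqF// poweRe1; last first.
  by apply: integral_ge0 => x _; rewrite lee_fin mulr_ge0 ?powR_ge0// ltW.
rewrite (_ : (q'^-1 * q)%R = (q - 1)%R); last first.
  by rewrite /q'; field; rewrite !gt_eqF.
apply; rewrite in_itv/= leey andbT ?mule_ge0 ?poweR_ge0//.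
by apply: integral_ge0.
Qed.

End weighted_hoelder.

Section muckenhoupt.
Context (R : realType) (n : nat).
Hypothesis n_gt0 : (0 < n)%N.
Local Open Scope ereal_scope.

Lemma lebesgue_ball_fin (x : Rn R n) (r : R) : (0 < r)%R ->
  exists2 m : R, (0 < m)%R & lebesgue_rn R n (eucl_ball x r) = m%:E.
Proof.
move=> r0; have /andP[h1 h2] := lebesgue_ball_bounds x n_gt0 r0.
have fn : lebesgue_rn R n (eucl_ball x r) \is a fin_num.
  by rewrite ge0_fin_numE//; exact: le_lt_trans h2 (ltry _).
exists (fine (lebesgue_rn R n (eucl_ball x r))); last by rewrite fineK.
rewrite -lte_fin fineK//; apply: lt_le_trans h1.
by rewrite lte_fin mulr_gt0 ?exprn_gt0 ?divr_gt0 ?ltr0n.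
Qed.

Variable phi : Rn R n -> R -> R.
Hypothesis phi_gt0 : forall x (t : R), (0 < t -> 0 < phi x t)%R.

(** A_1 is contained in A_2: the integral of 1/w over a ball is at most the
    measure of the ball times the essential supremum of 1/w. *)
Lemma muckenhoupt_constant2_le (t : R) (x : Rn R n) (r : R) :
  (0 < t)%R -> (0 < r)%R ->
  muckenhoupt_constant phi 2 t (eucl_ball x r) <=
  muckenhoupt_constant1 phi t (eucl_ball x r).
Proof.
move=> t0 r0; rewrite /muckenhoupt_constant /muckenhoupt_constant1.
set B := eucl_ball x r; have [m m0 mE] := lebesgue_ball_fin x r0.
have mB : measurable B by exact: measurable_eucl_ball.
set E := ess_sup _ _.
have EP : \forall y \ae lebesgue_rn R n, ((fun y => (phi y t)^-1%:E) \_ B) y <= E.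
  exact: ess_sup_ge.
have E0 : 0 <= E.
  have [|y By /= yE] := @ae_exists _ _ _ (lebesgue_rn R n) B _ mB _ EP.
    by rewrite [X in _ < X](_ : _ = m%:E)// lte_fin.
  apply: le_trans yE; rewrite patchE mem_set// lee_fin invr_ge0 ltW//.
  exact: phi_gt0.
rewrite (_ : (2 - 1)%R = 1%R :> R); last by lra.
rewrite invr1 poweRe1; last by apply: integral_ge0 => y _; rewrite lee_fin powR_ge0.
have VE : \int[lebesgue_rn R n]_(y in B) (phi y t `^ (-1))%:E <= E * m%:E.
  apply: (@le_trans _ _ (\int[lebesgue_rn R n]_(y in B) (E * 1))).
    apply: ge0_ae_le_integral_in => [y _|y _|].
    - by rewrite lee_fin powR_ge0.
    - by rewrite mule1.
    - apply: filterS EP => y + By; rewrite patchE mem_set// mule1 powR_inv1//.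
      by rewrite ltW// phi_gt0.
  rewrite ge0_integralZl//.
  by rewrite integral_cst// mul1e [X in _ * X](_ : _ = m%:E).
rewrite [X in (X `^ 2)^-1](_ : _ = m%:E)// [X in _ <= X^-1 * _ * _](_ : _ = m%:E)//.
rewrite poweR_EFin powR_mulrn ?(ltW m0)//.
have W0 : 0 <= \int[lebesgue_rn R n]_(y in B) (phi y t)%:E.
  by apply: integral_ge0 => y _; rewrite lee_fin ltW// phi_gt0.
apply: (@le_trans _ _ ((m ^+ 2)%:E^-1 * \int[lebesgue_rn R n]_(y in B) (phi y t)%:E * (E * m%:E))).
  apply: lee_wpmul2l => //; apply: mule_ge0 => //.
  by rewrite inver gt_eqF ?exprn_gt0// lee_fin invr_ge0 exprn_ge0// ltW.
rewrite [E * _]muleC muleA !inver !gt_eqF ?exprn_gt0//.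
rewrite (muleAC _ _ m%:E) -EFinM (_ : (m ^- 2 * m)%R = m^-1%R)//.
by field; rewrite gt_eqF.
Qed.

(** Thanks to the inclusion of A_1 in A_2, the exponent can be taken greater
    than 1, which is what Hoelder's inequality needs. *)
Lemma muckenhoupt_infty_gt1 : muckenhoupt_infty phi ->
  exists q A : R, [/\ (1 < q)%R, (0 <= A)%R & forall (t : R) x (r : R),
    (0 < t)%R -> (0 < r)%R ->
    muckenhoupt_constant phi q t (eucl_ball x r) <= A%:E].
Proof.
move=> [q q1]; rewrite /muckenhoupt; set S := [set z | _] => Soo.
have [A A0 SA] : exists2 A : R, (0 <= A)%R & forall z, S z -> z <= A%:E.
  case E : (ereal_sup S) Soo => [r| |]// _.
    exists `|r|%R => // z Sz; apply: (@le_trans _ _ r%:E).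
      by rewrite -E; exact: ereal_sup_ubound.
    by rewrite lee_fin ler_norm.
  exists 0%R => // z Sz; apply: (@le_trans _ _ -oo); last exact: leNye.
  by rewrite -E; exact: ereal_sup_ubound.
have [q1'|q1'] := eqVneq q 1%R.
  exists 2%R, A; split => // [|t x r t0 r0]; first by rewrite ltr1n.
  apply: le_trans (muckenhoupt_constant2_le x t0 r0) _; apply: SA.
  by exists t, x, r; rewrite q1' eqxx.
exists q, A; split => // [|t x r t0 r0]; first by rewrite lt_neqAle eq_sym q1' q1.
by apply: SA; exists t, x, r; rewrite (negbTE q1').
Qed.

(** By Hoelder's inequality, (average of h)^q <= (weighted integral of h^q)
    times the dual factor of the Muckenhoupt constant. The weight is replaced by
    a Borel function [w] that is equal to it almost everywhere. *)
Lemma muckenhoupt_weight (q A t : R) (w : Rn R n -> R) x (r : R) (h : Rn R n -> R) lam :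
  (1 < q)%R -> (0 < t)%R -> (0 <= A)%R ->
  muckenhoupt_constant phi q t (eucl_ball x r) <= A%:E ->
  measurable_fun setT w -> (forall y, 0 < w y)%R ->
  (\forall y \ae lebesgue_rn R n, phi y t = w y) -> (0 < r)%R ->
  measurable_fun setT h -> (forall y, 0 <= h y)%R -> (0 < lam)%R ->
  lam%:E * lebesgue_rn R n (eucl_ball x r) <
    \int[lebesgue_rn R n]_(y in eucl_ball x r) (h y)%:E ->
  (lam `^ q)%:E * \int[lebesgue_rn R n]_(y in eucl_ball x r) (w y)%:E <=
    A%:E * \int[lebesgue_rn R n]_(y in eucl_ball x r) (h y `^ q * w y)%:E.
Proof.
move=> q1 t0 A0; rewrite /muckenhoupt_constant.
set B := eucl_ball x r => cA mw w0 phiw r0 mh h0 lam0 hB.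
have [m m0 mE] := lebesgue_ball_fin x r0.
have mB : measurable B by exact: measurable_eucl_ball.
have q0 : (0 < q)%R by exact: lt_trans q1.
move: cA.
rewrite [X in (X `^ q)^-1](_ : _ = m%:E)//.
rewrite (@ae_eq_lower_integral _ _ _ (lebesgue_rn R n) B
  (fun y => (phi y t)%:E) (fun y => (w y)%:E)); last first.
  by apply: filterS phiw => y ->.
rewrite (@ae_eq_lower_integral _ _ _ (lebesgue_rn R n) B
  (fun y => (phi y t `^ _)%:E)
  (fun y => (w y `^ (- (q - 1)^-1))%:E)); last first.
  by apply: filterS phiw => y ->.
have := @weighted_hoelder _ _ _ (lebesgue_rn R n) B h w q mB mh mw h0 w0 q1.
rewrite [lebesgue_rn R n _](_ : _ = m%:E)// in hB.
set I := \int[_]_(y in B) (h y)%:E in hB *.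
set X := \int[_]_(y in B) (h y `^ q * w y)%:E.
set V := \int[_]_(y in B) (w y `^ _)%:E.
set W := \int[_]_(y in B) (w y)%:E => IX cA.
have W0 : 0 <= W by apply: integral_ge0 => y _; rewrite lee_fin ltW.
have X0 : 0 <= X by apply: integral_ge0 => y _; rewrite lee_fin mulr_ge0 ?powR_ge0// ltW.
have mq0 : (0 < m `^ q)%R by rewrite powR_gt0.
have lI : ((lam * m) `^ q)%:E <= I `^ q.
  rewrite -poweR_EFin; apply: gt0_ler_poweR; rewrite ?(ltW q0)//.
  - by rewrite in_itv/= leey lee_fin mulr_ge0// ltW.
  - rewrite in_itv/= leey andbT; apply: le_trans (ltW hB).
    by rewrite -EFinM lee_fin mulr_ge0// ltW.
  - by rewrite EFinM ltW.
rewrite poweR_EFin inver gt_eqF// in cA.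
have V0 : 0 <= V `^ (q - 1) by exact: poweR_ge0.
apply: (@le_trans _ _ (X * V `^ (q - 1) * ((m `^ q)^-1%:E * W))).
  rewrite (_ : (lam `^ q)%:E * W = ((lam * m) `^ q)%:E * ((m `^ q)^-1%:E * W)).
    apply: lee_wpmul2r; last exact: le_trans lI IX.
    by rewrite mule_ge0// lee_fin invr_ge0 ltW.
  rewrite muleA -EFinM powRM ?(ltW lam0) ?(ltW m0)// mulfK// gt_eqF//.
rewrite -muleA [A%:E * _]muleC; apply: lee_wpmul2l => //.
by rewrite muleC.
Qed.

End muckenhoupt.

(** * Summation over dyadic levels: the modular inequality *)

Section dyadic_levels.
Context (R : realType).

Lemma expn2_unbounded (x : R) : exists k, x <= 2 ^+ k.
Proof.
exists (Num.bound `|x|); apply: le_trans (ler_norm _) _.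
apply: le_trans (ltW (archi_boundP (normr_ge0 x))) _.
by rewrite -natrX ler_nat ltnW// ltn_expl.
Qed.

Lemma dyadic_level (r : R) : 0 < r -> exists j : nat,
  2 ^+ j < r <= 2 * 2 ^+ j \/ 2 ^- j < r <= 2 * 2 ^- j.
Proof.
move=> r0.
have p2 k : 0 < 2 ^+ k :> R by rewrite exprn_gt0.
have [r1|r1] := ltP 1 r.
  case: (ex_minnP (expn2_unbounded r)) => -[|j] rj jmin; first by move: rj; rewrite expr0 leNgt r1.
  exists j; left; rewrite -exprS rj andbT ltNge; apply/negP => /jmin.
  by rewrite ltnn.
have exk : exists k, 2 ^- k < r.
  have [k kr] := expn2_unbounded (r^-1 + 1); exists k.
  rewrite -[ltRHS]invrK ltf_pV2 ?posrE ?invr_gt0//.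
  by apply: lt_le_trans kr; rewrite ltrDl.
case: (ex_minnP exk) => -[|j] rj jmin; first by move: rj; rewrite expr0 invr1 ltNge r1.
exists j.+1; right; rewrite rj /= leNgt; apply/negP => jr.
have : 2 ^- j < r by apply: le_lt_trans jr; rewrite exprS invfM mulrA divff ?mul1r.
by move=> /jmin; rewrite ltnn.
Qed.

(** A geometric term s^sigma with s < 1 is a multiple of the increment between
    s/2 and s of min(., 1)^sigma, and these increments are nonnegative for all
    s. Sums over dyadic s therefore telescope, with a bound that depends
    neither on the number of terms nor on the base point. *)
Lemma truncated_power_increment (sigma s : R) : 0 < sigma -> 0 < s ->
  s `^ sigma * (s < 1)%R%:R <=
  (1 - 2^-1 `^ sigma)^-1 *
  (Order.min s 1 `^ sigma - Order.min (s / 2) 1 `^ sigma).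
Proof.
move=> sg0 s0; have pow1 : 1 `^ sigma = 1 :> R by rewrite powR1.
have h1 : 2^-1 `^ sigma < 1 :> R.
  rewrite -[ltRHS]pow1; apply: gt0_ltr_powR; rewrite ?nnegrE//.
  by rewrite invf_lt1// ltr1n.
have c0 : 0 < 1 - 2^-1 `^ sigma :> R by rewrite subr_gt0.
case: ltP => s1 /=; last first.
  rewrite mulr0 mulr_ge0 ?invr_ge0 ?(ltW c0)// subr_ge0.
  apply: ge0_ler_powR; rewrite ?nnegrE ?(ltW sg0) ?le_min ?ler01 ?andbT ?divr_ge0 ?(ltW s0)//.
  by rewrite ge_min lexx orbT.
rewrite mulr1 (min_idPl _); last first.
  by rewrite ler_pdivrMr// mul1r (le_trans (ltW s1))// ler1n.
rewrite powRM ?(ltW s0)// ler_pdivlMl// mulrBl mul1r mulrC.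
by rewrite le_eqVlt mulrC eqxx.
Qed.

(** The levels 2^j and 2^-j are treated together, so that a sum over all
    dyadic levels is a series indexed by the natural numbers. *)
Lemma sum_truncated_power (sigma s : R) (J : nat) : 0 < sigma -> 0 < s ->
  \sum_(j < J) ((2 ^+ j * s) `^ sigma * (2 ^+ j * s < 1)%R%:R +
                (2 ^- j * s) `^ sigma * (2 ^- j * s < 1)%R%:R) <=
  2 * (1 - 2^-1 `^ sigma)^-1.
Proof.
move=> sg0 s0; have pow1 : 1 `^ sigma = 1 :> R by rewrite powR1.
have h1 : 2^-1 `^ sigma < 1 :> R.
  rewrite -[ltRHS]pow1; apply: gt0_ltr_powR; rewrite ?nnegrE//.
  by rewrite invf_lt1// ltr1n.
have c0 : 0 < 1 - 2^-1 `^ sigma :> R by rewrite subr_gt0.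
pose m (u : R) := Order.min u 1 `^ sigma.
have m0 u : 0 <= m u by exact: powR_ge0.
have m1 u : 0 < u -> m u <= 1.
  move=> u0; rewrite -[leRHS]pow1; apply: ge0_ler_powR; rewrite ?nnegrE ?(ltW sg0)//.
    by rewrite le_min ler01 ltW.
  by rewrite ge_min lexx orbT.
have p2 k : 0 < 2 ^+ k :> R by rewrite exprn_gt0.
apply: (@le_trans _ _ (\sum_(j < J) (1 - 2^-1 `^ sigma)^-1 *
   ((m (2 ^+ j.+1 * (s / 2)) - m (2 ^+ j * (s / 2))) - (m (2 ^- j.+1 * s) - m (2 ^- j * s))))).
  apply: ler_sum => j _.
  have H1 := @truncated_power_increment sigma (2 ^+ j * s) sg0 (mulr_gt0 (p2 _) s0).
  have H2 := @truncated_power_increment sigma (2 ^- j * s) sg0 _.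
  apply: le_trans (lerD H1 (H2 _)) _; first by rewrite mulr_gt0// invr_gt0.
  rewrite -mulrDr ler_pM2l ?invr_gt0// -!/(m _) -!mulrA.
  rewrite (_ : 2 ^+ j.+1 * (s / 2) = 2 ^+ j * s); last by rewrite exprS; field.
  rewrite (_ : 2 ^- j.+1 * s = 2 ^- j * (s / 2)); last first.
    by rewrite exprS; field; rewrite gt_eqF.
  by rewrite le_eqVlt; apply/orP; left; apply/eqP; ring.
rewrite -mulr_sumr mulrC ler_pM2r ?invr_gt0// sumrB.
rewrite -(big_mkord xpredT (fun j => m (2 ^+ j.+1 * (s / 2)) - m (2 ^+ j * (s / 2)))).
rewrite -(big_mkord xpredT (fun j => m (2 ^- j.+1 * s) - m (2 ^- j * s))).
rewrite (@telescope_sumr _ 0 J (fun j => m (2 ^+ j * (s / 2))))//.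
rewrite (@telescope_sumr _ 0 J (fun j => m (2 ^- j * s)))//.
have e1 := m1 (2 ^+ J * (s / 2)) (mulr_gt0 (p2 _) (divr_gt0 s0 (ltr0n _ 2))).
have e2 : m (2 ^- 0 * s) <= 1 by rewrite expr0 invr1 mul1r m1.
have e3 := m0 (2 ^+ 0 * (s / 2)); have e4 := m0 (2 ^- J * s).
by lra.
Qed.

End dyadic_levels.

Section modular_inequality.
Context (R : realType) (n : nat).
Hypothesis n_gt0 : (0 < n)%N.
Variable phi : Rn R n -> R -> R.
Hypothesis phi_mono : forall x (s t : R), 0 <= s -> s <= t -> phi x s <= phi x t.
Hypothesis phi0 : forall x, phi x 0 = 0.
Hypothesis phi_gt0 : forall x (t : R), 0 < t -> 0 < phi x t.
Hypothesis phi_infty : forall x, phi x t @[t --> +oo] --> +oo.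
Hypothesis phi_ae : forall t : R, 0 <= t ->
  ae_measurable (lebesgue_rn R n) (phi ^~ t : _ -> measurableTypeR R).
Variables (p Cl Cu q A : R).
Hypothesis Cl_gt0 : 0 < Cl.
Hypothesis Cu_gt0 : 0 < Cu.
Hypothesis phi_lower : forall x (t s : R), 0 <= t -> 0 <= s <= 1 ->
    phi x (s * t) <= Cl * s `^ p * phi x t.
Hypothesis phi_upper : forall x (t s : R), 0 <= t -> 1 <= s ->
    phi x (s * t) <= Cu * s `^ 1 * phi x t.
Hypothesis q_gt1 : 1 < q.
Hypothesis A_ge0 : 0 <= A.
Hypothesis phi_muckenhoupt : forall (t : R) x (r : R), 0 < t -> 0 < r ->
  (muckenhoupt_constant phi q t (eucl_ball x r) <= A%:E)%E.

Lemma weight_version (t : R) : 0 < t -> exists w : Rn R n -> R,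
  [/\ measurable_fun setT w, forall x, 0 < w x &
      \forall x \ae lebesgue_rn R n, phi x t = w x].
Proof.
move=> t0; have [g mg phig] := phi_ae (ltW t0).
(* The value 1 is taken only on a null set; it keeps the version positive. *)
exists (fun x => if 0 < (g x : R) then (g x : R) else 1); split => [|x|].
- by apply: measurable_fun_ifT => //; apply: measurable_fun_ltr.
- by case: ifP.
- by apply: filterS phig => x /(_ I) gx; rewrite -gx phi_gt0.
Qed.

Variables (r kappa : R).
Hypothesis r_gt0 : 0 < r.
Hypothesis kappa_gt0 : 0 < kappa.
Hypothesis sigma_gt0 : 0 < p - r * q.

Let q_gt0 : 0 < q. Proof. exact: lt_trans q_gt1. Qed.

(* Chosen so that (kappa' rho)^r is half of (kappa rho)^r, the height at which
   the function is truncated. *)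
Let kappa' := kappa * 2 `^ (- r^-1).

Let kappa'_gt0 : 0 < kappa'.
Proof. by rewrite mulr_gt0// powR_gt0. Qed.

Let mu : {measure set (Rn R n) -> \bar R} := lebesgue_rn R n.

Let c1 : R := (2 / n%:R) ^+ n.
Let c2 : R := 2 ^+ n.
Let c1_gt0 : 0 < c1. Proof. by rewrite exprn_gt0// divr_gt0// ltr0n. Qed.
Let ratio : R := 3 ^+ n * c2 / c1.
Let ratio_gt0 : 0 < ratio. Proof. by rewrite divr_gt0// mulr_gt0// exprn_gt0. Qed.

(** The right-hand side of the weak type inequality for the weight phi(., rho)
    at the height of level rho. *)
Definition modular_level (G w : Rn R n -> R) (rho : R) (x : Rn R n) : R :=
  (G x `^ r / (kappa' * rho) `^ r) `^ q * w x * (kappa' * rho < G x)%R%:R.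

Lemma measurable_modular_level (G w : Rn R n -> R) (rho : R) :
  measurable_fun setT G -> measurable_fun setT w ->
  measurable_fun setT (modular_level G w rho).
Proof.
move=> mG mw; apply: measurable_funM; last first.
  apply: (measurableT_comp (f := fun b : bool => b%:R : R)) => //.
  exact: measurable_fun_ltr.
apply: measurable_funM => //.
apply: (measurableT_comp (f := fun x : R => (x `^ q)%R)); first exact: measurable_powR.
apply: measurable_funM => //.
by apply: (measurableT_comp (f := fun x : R => (x `^ r)%R)) => //; exact: measurable_powR.
Qed.

(** Truncating G^r at half the height produces the indicator function in
    [modular_level]. *)
Lemma weak_type_level (G w : Rn R n -> R) (rho : R) : 0 < rho ->
  measurable_fun setT G -> (forall x, 0 <= G x) ->
  measurable_fun setT w -> (forall x, 0 < w x) ->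
  (\forall x \ae lebesgue_rn R n, phi x rho = w x) ->
  (\int[mu]_(x in hl_level mu (fun x => G x `^ r)%R ((kappa * rho) `^ r)%R) (w x)%:E <=
   (A * ratio `^ q)%:E * \int[mu]_x (modular_level G w rho x)%:E)%E.
Proof.
move=> rho0 mG G0 mw w0 phiw.
have mGr : measurable_fun setT (fun x => G x `^ r).
  by apply: (measurableT_comp (f := fun x : R => (x `^ r)%R)) => //; exact: measurable_powR.
have lam0 : 0 < (kappa * rho) `^ r by rewrite powR_gt0// mulr_gt0.
have half : (kappa * rho) `^ r / 2 = (kappa' * rho) `^ r.
  rewrite /kappa' mulrAC [RHS]powRM ?powR_ge0 ?mulr_ge0 ?(ltW kappa_gt0) ?(ltW rho0)//.
  by rewrite -powRrM mulNr mulVf ?gt_eqF// powR_inv1.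
have bnd x s : 0 < s -> ((c1 * s ^+ n)%:E <= mu (eucl_ball x s) <= (c2 * s ^+ n)%:E)%E.
  exact: lebesgue_ball_bounds.
have tr := hl_level_truncate bnd mGr (fun x => powR_ge0 _ _) lam0.
set h := (fun x => G x `^ r * _) in tr.
have mh : measurable_fun setT h.
  apply: measurable_funM => //.
  apply: (measurableT_comp (f := fun b : bool => b%:R : R)) => //.
  exact: measurable_fun_ltr.
have h0 x : 0 <= h x by rewrite /h mulr_ge0 ?powR_ge0.
apply: (@le_trans _ _ (\int[mu]_(x in hl_level mu h ((kappa * rho) `^ r / 2)) (w x)%:E)%E).
  apply: ge0_subset_integral => //.
  - exact: measurable_hl_level.
  - exact: measurable_hl_level.
  - by apply/measurable_EFinP; exact: measurable_funTS.
  - by move=> x _; rewrite lee_fin ltW.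
have := @weak_type R n mu c1 c2 c1_gt0 bnd w q A (fun x => ltW (w0 x)) mw q_gt0 A_ge0 _ h _ mh h0
  (divr_gt0 lam0 (ltr0n _ 2)).
move=> /(_ _)/le_trans; apply.
  move=> x s h' l s0 mh' h'0 l0.
  exact: (muckenhoupt_weight n_gt0 q_gt1 rho0 A_ge0 (phi_muckenhoupt x rho0 s0)).
rewrite half -/ratio !EFinM -!muleA; apply: lee_wpmul2l; first by rewrite lee_fin.
have mlev : measurable_fun setT (fun x => (modular_level G w rho x)%:E).
  by apply/measurable_EFinP; exact: measurable_modular_level.
have mhw : measurable_fun setT (fun x => (h x `^ q * w x)%:E).
  apply/measurable_EFinP; apply: measurable_funM => //.
  by apply: (measurableT_comp (f := fun x : R => (x `^ q)%R)) => //; exact: measurable_powR.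
rewrite -ge0_integralZl//; last 2 first.
- by move=> x _; rewrite lee_fin mulr_ge0 ?powR_ge0// ltW.
- by rewrite lee_fin powR_ge0.
rewrite -ge0_integralZl//; last 2 first.
- by move=> x _; rewrite lee_fin !mulr_ge0 ?powR_ge0// ltW.
- by rewrite lee_fin powR_ge0.
have l'0 : 0 < (kappa' * rho) `^ r by rewrite powR_gt0// mulr_gt0.
apply: ge0_le_lower_integral => x _.
- by rewrite -EFinM lee_fin !mulr_ge0 ?powR_ge0// ltW.
- by rewrite -EFinM lee_fin !mulr_ge0 ?powR_ge0// ltW.
rewrite -!EFinM lee_fin /h half /modular_level.
case: (ltP ((kappa' * rho) `^ r)) => hG; last first.
  rewrite mulr0 powR0 ?gt_eqF// mul0r mulr0.
  by rewrite !mulr_ge0 ?powR_ge0// ltW.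
have -> : kappa' * rho < G x.
  rewrite ltNge; apply/negP => GK; move: hG; rewrite ltNge => /negP; apply.
  by apply: ge0_ler_powR; rewrite ?nnegrE ?(ltW r_gt0) ?(ltW (mulr_gt0 kappa'_gt0 rho0)).
have divpow a b : 0 <= a -> 0 <= b -> (a / b) `^ q = a `^ q * b^-1 `^ q.
  by move=> a0 b0; rewrite powRM// invr_ge0.
rewrite !mulr1 (divpow ratio) ?(ltW ratio_gt0) ?(ltW l'0)//.
rewrite (divpow (G x `^ r)) ?powR_ge0//.
by rewrite le_eqVlt; apply/orP; left; apply/eqP; ring.
Qed.

Let Ck := Cu * (1 + kappa'^-1).

(** Where G exceeds kappa' rho, the lower type of phi gives a gain s^p with
    s = kappa' rho / G < 1, against the loss s^(-rq) of the weak type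
    inequality. The net exponent p - rq is positive by the choice of r. *)
Lemma modular_level_le (G w : Rn R n -> R) (rho : R) x : 0 < rho -> 0 <= G x ->
  phi x rho = w x ->
  modular_level G w rho x <=
  Cl * Ck * phi x (G x) * ((rho * (kappa' / G x)) `^ (p - r * q) * (rho * (kappa' / G x) < 1)%R%:R).
Proof.
move=> rho0 G0 phiw; rewrite /modular_level -phiw.
have phi_ge0 t : 0 <= t -> 0 <= phi x t.
  by rewrite le_eqVlt => /predU1P[<-|/phi_gt0/ltW//]; rewrite phi0.
have Ck0 : 0 <= Ck.
  by rewrite mulr_ge0 ?(ltW Cu_gt0)// addr_ge0// invr_ge0 ltW.
case: ltP => hG; last first.
  rewrite mulr0; apply: mulr_ge0; last by rewrite mulr_ge0// powR_ge0.
  exact: mulr_ge0 (mulr_ge0 (ltW Cl_gt0) Ck0) (phi_ge0 _ G0).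
have kr0 : 0 < kappa' * rho by rewrite mulr_gt0.
have Gx0 : 0 < G x by exact: lt_trans hG.
pose s := rho * (kappa' / G x).
have sE : s = kappa' * rho / G x by rewrite /s; ring.
have s0 : 0 < s by rewrite sE divr_gt0.
have s1 : s < 1 by rewrite sE ltr_pdivrMr// mul1r.
rewrite -/s s1 !mulr1.
have sinv : G x `^ r / (kappa' * rho) `^ r = s `^ (- r).
  have Vr : (G x)^-1 `^ r = (G x `^ r)^-1.
    by rewrite -(powR_inv1 (ltW Gx0)) powRAC powR_inv1// powR_ge0.
  rewrite sE powRN [in RHS]powRM ?(ltW kr0) ?invr_ge0 ?(ltW Gx0)// Vr.
  by rewrite invfM invrK mulrC.
rewrite sinv -powRrM mulNr.
have H1 : phi x rho <= Cl * s `^ p * phi x (G x / kappa').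
  rewrite [X in phi x X](_ : rho = s * (G x / kappa')).
    by apply: phi_lower; rewrite ?divr_ge0 ?(ltW Gx0) ?(ltW kappa'_gt0)// (ltW s0) ltW.
  by rewrite sE; field; rewrite !gt_eqF.
have H2 : phi x (G x / kappa') <= Ck * phi x (G x).
  apply: (@le_trans _ _ (phi x ((1 + kappa'^-1) * G x))).
    apply: phi_mono; first by rewrite divr_ge0// ltW.
    by rewrite mulrC ler_wpM2r// lerDr.
  have := @phi_upper x (G x) (1 + kappa'^-1) G0; rewrite powRr1; last first.
    by rewrite addr_ge0// invr_ge0 ltW.
  by apply; rewrite lerDl invr_ge0 ltW.
have sp q' : 0 <= s `^ q' by exact: powR_ge0.
apply: (@le_trans _ _ (s `^ (- (r * q)) * (Cl * s `^ p * (Ck * phi x (G x))))).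
  apply: ler_wpM2l => //; apply: le_trans H1 _; apply: ler_wpM2l => //.
  by rewrite mulr_ge0// ltW.
rewrite powRD; last by rewrite (gt_eqF s0) implybT.
by rewrite le_eqVlt; apply/orP; left; apply/eqP; ring.
Qed.

(** phi(x, f) is at most a multiple of phi(x, rho) for the dyadic level rho just
    below f, by the upper type. If f is infinite, all levels 2^j contribute and
    phi(x, 2^j) is unbounded. *)
Lemma growth_ext_le_levels (f : \bar R) (F : nat -> R) x : (0 <= f)%E ->
  (forall j, 0 <= F j) ->
  (forall j, ((2 ^+ j)%:E < f)%E -> phi x (2 ^+ j) <= F j) ->
  (forall j, ((2 ^- j)%:E < f)%E -> phi x (2 ^- j) <= F j) ->
  (growth_ext phi x f <= (2 * Cu)%:E * \sum_(j <oo) (F j)%:E)%E.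
Proof.
move=> f0 F0 Fp Fm.
have term j : ((F j)%:E <= \sum_(j <oo) (F j)%:E)%E.
  have := @nneseries_lim_ge _ (fun j => (F j)%:E) xpredT 0 j.+1 (fun j _ _ => F0 j).
  apply: le_trans; rewrite big_nat_recr//= leeDr// sume_ge0// => i _.
  by rewrite lee_fin.
have CC : 0 < 2 * Cu by rewrite mulr_gt0.
case: f f0 Fp Fm => [f| |]//= f0 Fp Fm; last first.
  suff -> : (\sum_(j <oo) (F j)%:E = +oo)%E by rewrite gt0_muley// lte_fin.
  apply/eqyP => M M0.
  have /cvgryPge/(_ M)[X [_ XM]] := @phi_infty x.
  have [j Xj] := expn2_unbounded (X + 1).
  apply: le_trans (term j); rewrite lee_fin; apply: le_trans (Fp j _); last exact: ltry.
  by apply: XM; apply: lt_le_trans Xj; rewrite ltrDl.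
move: f0; rewrite lee_fin le_eqVlt => /predU1P[<-|f0].
  rewrite phi0 mule_ge0 ?lee_fin ?(ltW CC)//; apply: nneseries_ge0 => j _ _.
  by rewrite lee_fin.
have step rho j : 0 < rho -> rho < f <= 2 * rho -> phi x rho <= F j ->
    ((phi x f)%:E <= (2 * Cu)%:E * \sum_(j <oo) (F j)%:E)%E.
  move=> rho0 /andP[_ f2] phiF.
  apply: (@le_trans _ _ ((2 * Cu)%:E * (F j)%:E)%E); last first.
    by apply: lee_wpmul2l => //; rewrite lee_fin ltW.
  rewrite -EFinM lee_fin; apply: le_trans (phi_mono x (ltW f0) f2) _.
  have := @phi_upper x rho 2 (ltW rho0); rewrite powRr1// => /(_ _)/le_trans; apply.
    by rewrite ler1n.
  by rewrite [2 * Cu]mulrC ler_wpM2l// mulr_ge0// ltW.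
have [j [] rj] := dyadic_level f0.
  apply: (step _ j _ rj); first by rewrite exprn_gt0.
  by apply: Fp; rewrite lte_fin; case/andP: rj.
apply: (step _ j _ rj); first by rewrite invr_gt0 exprn_gt0.
by apply: Fm; rewrite lte_fin; case/andP: rj.
Qed.

(** If every superlevel set of f is contained in the corresponding superlevel
    set of M(G^r), that is, if f <= C M(G^r)^(1/r), then the modular of f is
    bounded by that of G: sum the weak type inequalities over the dyadic
    levels, each with its own weight, and exchange sum and integral. *)
Lemma modular_inequality : exists2 C : R, 0 < C &
  forall (G : Rn R n -> R) (f : Rn R n -> \bar R),
    measurable_fun setT G -> (forall x, 0 <= G x) -> (forall x, (0 <= f x)%E) ->
    (forall x (a : R), 0 < a -> (a%:E < f x)%E ->
      hl_level mu (fun x => G x `^ r) ((kappa * a) `^ r) x) ->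
    (\int[mu]_x growth_ext phi x (f x) <= C%:E * \int[mu]_x (phi x (G x))%:E)%E.
Proof.
have p2 j : 0 < 2 ^+ j :> R by rewrite exprn_gt0.
have m2 j : 0 < 2 ^- j :> R by rewrite invr_gt0.
have /choice[wp wpP] := fun j : nat => weight_version (p2 j).
have /choice[wm wmP] := fun j : nat => weight_version (m2 j).
pose sg := p - r * q.
pose C3 := (1 - 2^-1 `^ sg)^-1 : R.
pose C2 := A * ratio `^ q.
have C20 : 0 <= C2 by rewrite mulr_ge0 ?powR_ge0.
have Ck0 : 0 < Ck by rewrite mulr_gt0// addr_gt0// invr_gt0.
have C30 : 0 < C3.
  have pow1 : 1 `^ sg = 1 :> R by rewrite powR1.
  rewrite invr_gt0 subr_gt0 -[ltRHS]pow1; apply: gt0_ltr_powR; rewrite ?nnegrE//.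
  by rewrite invf_lt1// ltr1n.
pose C4 := Cl * Ck * (2 * C3).
have C40 : 0 < C4 by exact: mulr_gt0 (mulr_gt0 Cl_gt0 Ck0) (mulr_gt0 (ltr0n _ 2) C30).
have C50 : 0 <= 2 * Cu * C2 by apply: mulr_ge0 => //; rewrite mulr_ge0// ltW.
exists (2 * Cu * C2 * C4 + 1).
  by apply: ltr_wpDl => //; exact: mulr_ge0 C50 (ltW C40).
move=> G f mG G0 f0 fG.
pose E rho := hl_level mu (fun x => G x `^ r) ((kappa * rho) `^ r).
have mE rho : measurable (E rho) by exact: measurable_hl_level.
pose Fp j x := wp j x * \1_(E (2 ^+ j)) x : R.
pose Fm j x := wm j x * \1_(E (2 ^- j)) x : R.
have mFp j : measurable_fun setT (Fp j).
  by apply: measurable_funM => //; have [] := wpP j.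
have mFm j : measurable_fun setT (Fm j).
  by apply: measurable_funM => //; have [] := wmP j.
have Fp0 j x : 0 <= Fp j x by rewrite mulr_ge0// ltW//; have [_ ->] := wpP j.
have Fm0 j x : 0 <= Fm j x by rewrite mulr_ge0// ltW//; have [_ ->] := wmP j.
pose Hp j := modular_level G (wp j) (2 ^+ j).
pose Hm j := modular_level G (wm j) (2 ^- j).
have mHp j : measurable_fun setT (Hp j).
  by apply: measurable_modular_level => //; have [] := wpP j.
have mHm j : measurable_fun setT (Hm j).
  by apply: measurable_modular_level => //; have [] := wmP j.
have Hp0 j x : 0 <= Hp j x.
  by rewrite !mulr_ge0 ?powR_ge0// ltW//; have [_ ->] := wpP j.
have Hm0 j x : 0 <= Hm j x.
  by rewrite !mulr_ge0 ?powR_ge0// ltW//; have [_ ->] := wmP j.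
have phiw : \forall x \ae mu, forall j,
    phi x (2 ^+ j) = wp j x /\ phi x (2 ^- j) = wm j x.
  apply: ae_foralln => j; have [_ _ h1] := wpP j; have [_ _ h2] := wmP j.
  by apply: filterS2 h1 h2 => x.
have phi_ge0 x t : 0 <= t -> 0 <= phi x t.
  by rewrite le_eqVlt => /predU1P[<-|/phi_gt0/ltW//]; rewrite phi0.
have growth0 x : (0 <= growth_ext phi x (f x))%E.
  by move: (f0 x); rewrite /growth_ext; case: (f x) => // t; rewrite !lee_fin => /phi_ge0.
have CC : 0 < 2 * Cu by rewrite mulr_gt0.
apply: (@le_trans _ _ (\int[mu]_x ((2 * Cu)%:E * \sum_(j <oo) (Fp j x + Fm j x)%:E))%E).
  apply: ge0_ae_le_integral => // [x|].
    rewrite mule_ge0 ?lee_fin ?(ltW CC)//; apply: nneseries_ge0 => j _ _.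
    by rewrite lee_fin addr_ge0.
  apply: filterS phiw => x xw; apply: growth_ext_le_levels => // [j|j jf|j jf].
  - by rewrite addr_ge0.
  - rewrite (xw j).1 /Fp indicE mem_set ?mulr1 ?lerDl//.
    exact: fG jf.
  - rewrite (xw j).2 /Fm indicE mem_set ?mulr1 ?lerDr//.
    exact: fG jf.
have mF j : measurable_fun setT (fun x => (Fp j x + Fm j x)%:E).
  by apply/measurable_EFinP; exact: measurable_funD.
have mH j : measurable_fun setT (fun x => (Hp j x + Hm j x)%:E).
  by apply/measurable_EFinP; exact: measurable_funD.
have intF j : (\int[mu]_x (Fp j x + Fm j x)%:E <= C2%:E * \int[mu]_x (Hp j x + Hm j x)%:E)%E.
  have split2 (a b : Rn R n -> R) : measurable_fun setT a -> measurable_fun setT b ->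
     (forall x, 0 <= a x) -> (forall x, 0 <= b x) ->
     (\int[mu]_x (a x + b x)%:E = \int[mu]_x (a x)%:E + \int[mu]_x (b x)%:E)%E.
    move=> ma mb a0 b0; rewrite -ge0_integralD//.
    - by move=> x _; rewrite lee_fin.
    - exact/measurable_EFinP.
    - by move=> x _; rewrite lee_fin.
    - exact/measurable_EFinP.
  have restr (w : Rn R n -> R) rho :
      (\int[mu]_x (w x * \1_(E rho) x)%:E = \int[mu]_(x in E rho) (w x)%:E)%E.
    rewrite [RHS]integral_mkcond; apply: eq_integral => x _.
    by rewrite patchE indicE; case: ifP => _; rewrite ?mulr1 ?mulr0.
  rewrite split2// split2// ge0_muleDr; last 2 first.
  - by apply: integral_ge0 => x _; rewrite lee_fin.
  - by apply: integral_ge0 => x _; rewrite lee_fin.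
  rewrite !restr; have [? ? ?] := wpP j; have [? ? ?] := wmP j.
  by apply: leeD; exact: weak_type_level.
rewrite ge0_integralZl//; last 3 first.
- by apply: ge0_emeasurable_sum => // j x _ _; rewrite lee_fin addr_ge0.
- by move=> x _; apply: nneseries_ge0 => j _ _; rewrite lee_fin addr_ge0.
- by rewrite lee_fin ltW.
rewrite integral_nneseries//; last by move=> j x _; rewrite lee_fin addr_ge0.
apply: (@le_trans _ _ ((2 * Cu)%:E * (C2%:E * \int[mu]_x \sum_(j <oo) (Hp j x + Hm j x)%:E))%E).
  apply: lee_wpmul2l; first by rewrite lee_fin ltW.
  rewrite integral_nneseries//; last by move=> j x _; rewrite lee_fin addr_ge0.
  rewrite -nneseriesZl; last first.
    by move=> j _; apply: integral_ge0 => x _; rewrite lee_fin addr_ge0.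
  apply: lee_nneseries => // j _ _.
  by apply: integral_ge0 => x _; rewrite lee_fin addr_ge0.
have HC : (\int[mu]_x \sum_(j <oo) (Hp j x + Hm j x)%:E <=
    C4%:E * \int[mu]_x (phi x (G x))%:E)%E.
  apply: le_trans (ge0_lower_integralZl_le _ C40 _); last first.
    by move=> x; rewrite lee_fin phi_ge0.
  apply: ge0_ae_le_integral => [x|x|].
  - by apply: nneseries_ge0 => j _ _; rewrite lee_fin addr_ge0.
  - by rewrite mule_ge0// lee_fin ?phi_ge0// ltW.
  apply: filterS phiw => x xw; apply: lime_le.
    by apply: is_cvg_nneseries => j _ _; rewrite lee_fin addr_ge0.
  apply: nearW => k; rewrite sumEFin -EFinM lee_fin big_mkord.
  have [Gx|Gx] := leP (G x) 0.
    have nlt rho : 0 < rho -> (kappa' * rho < G x) = false.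
      by move=> rho0; apply/negP/negP; rewrite -leNgt (le_trans Gx)// mulr_ge0// ltW.
    rewrite big1; first by rewrite mulr_ge0 ?(ltW C40)// phi_ge0.
    by move=> j _; rewrite /Hp /Hm /modular_level !nlt// !mulr0 addr0.
  have s0 : 0 < kappa' / G x by exact: divr_gt0.
  have := @sum_truncated_power _ sg (kappa' / G x) k sigma_gt0 s0.
  move=> /(ler_wpM2l (mulr_ge0 (mulr_ge0 (ltW Cl_gt0) (ltW Ck0)) (phi_ge0 x _ (G0 x)))).
  rewrite [in leRHS]mulrAC => /(le_trans _); apply.
  rewrite mulr_sumr; apply: ler_sum => j _; rewrite mulrDr; apply: lerD.
    by apply: modular_level_le => //; exact: (xw j).1.
  by apply: modular_level_le => //; exact: (xw j).2.
apply: (@le_trans _ _ ((2 * Cu * C2)%:E * (C4%:E * \int[mu]_x (phi x (G x))%:E))%E).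
  by rewrite [in leRHS]EFinM -muleA lee_wpmul2l ?lee_fin ?(ltW CC)// lee_wpmul2l ?lee_fin.
rewrite muleA -EFinM; apply: lee_wpmul2r; last by rewrite lee_fin lerDl.
by apply: integral_ge0 => x _; rewrite lee_fin phi_ge0.
Qed.


End modular_inequality.

(** * Modulus and integral of complex functions *)

Section complex_modulus.
Context (R : realType).
Implicit Types z : R[i].

Lemma cmod_ge0 z : 0 <= cmod z.
Proof. by case: z => a b; exact: sqrtr_ge0. Qed.

Lemma cmod_real_complex z : `|z| = (cmod z)%:C%C.
Proof. by []. Qed.

Lemma cmodD z1 z2 : cmod (z1 + z2) <= cmod z1 + cmod z2.
Proof.
have := ler_normD z1 z2; rewrite !cmod_real_complex -rmorphD /=.
by rewrite lecE /= eqxx.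
Qed.

Lemma cmodN z : cmod (- z) = cmod z.
Proof. by case: z => a b; rewrite /= !sqrrN. Qed.

Lemma cmodM z1 z2 : cmod (z1 * z2) = cmod z1 * cmod z2.
Proof. exact: Normc.normcM. Qed.

Lemma le_Re_cmod z : `|complex.Re z| <= cmod z.
Proof. by case: z => a b /=; rewrite -sqrtr_sqr ler_wsqrtr// lerDl sqr_ge0. Qed.

Lemma le_Im_cmod z : `|complex.Im z| <= cmod z.
Proof. by case: z => a b /=; rewrite -sqrtr_sqr ler_wsqrtr// lerDr sqr_ge0. Qed.

Lemma cmod_le_ReIm z : cmod z <= `|complex.Re z| + `|complex.Im z|.
Proof.
case: z => a b /=; rewrite -[leRHS]ger0_norm ?addr_ge0// -sqrtr_sqr ler_wsqrtr//.
rewrite sqrrD !real_normK ?num_real// -addrA [_ *+ 2 + _]addrC addrA lerDl.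
by rewrite mulrn_wge0// mulr_ge0.
Qed.

End complex_modulus.

Section complex_integral.
Context d (T : measurableType d) (R : realType).
Variable mu : {measure set T -> \bar R}.

Lemma ae_measurableM (f g : T -> measurableTypeR R) :
  ae_measurable mu f -> ae_measurable mu g ->
  ae_measurable mu (fun x => f x * g x : measurableTypeR R).
Proof.
apply: (@ae_measurable_comp2 _ _ _ _ _ _ _ _ _ _ f g (fun p => p.1 * p.2)).
exact: measurable_funM.
Qed.

Lemma ae_measurableD (f g : T -> measurableTypeR R) :
  ae_measurable mu f -> ae_measurable mu g ->
  ae_measurable mu (fun x => f x + g x : measurableTypeR R).
Proof.
apply: (@ae_measurable_comp2 _ _ _ _ _ _ _ _ _ _ f g (fun p => p.1 + p.2)).
exact: measurable_funD.
Qed.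

Lemma ae_measurableB (f g : T -> measurableTypeR R) :
  ae_measurable mu f -> ae_measurable mu g ->
  ae_measurable mu (fun x => f x - g x : measurableTypeR R).
Proof.
apply: (@ae_measurable_comp2 _ _ _ _ _ _ _ _ _ _ f g (fun p => p.1 - p.2)).
exact: measurable_funB.
Qed.

Lemma ae_measurableCM (f g : T -> R[i]) :
  ae_measurableC mu f -> ae_measurableC mu g ->
  ae_measurableC mu (fun x => f x * g x).
Proof.
move=> [fr fi] [gr gi]; split.
  rewrite (_ : (fun x => _) = (fun x => (complex.Re (f x) * complex.Re (g x)) -
     (complex.Im (f x) * complex.Im (g x)))).
    by apply: ae_measurableB; exact: ae_measurableM.
  by apply/funext => x; case: (f x) => a b; case: (g x).
rewrite (_ : (fun x => _) = (fun x => (complex.Re (f x) * complex.Im (g x)) +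
     (complex.Im (f x) * complex.Re (g x)))).
  by apply: ae_measurableD; exact: ae_measurableM.
by apply/funext => x; case: (f x) => a b; case: (g x).
Qed.

Lemma ae_abs_Rintegral_le (g : T -> measurableTypeR R) : ae_measurable mu g ->
  ((`| \int[mu]_x (g x : R) |)%:E <= \int[mu]_x (`|g x : R|)%:E)%E.
Proof.
move=> [h mh gh]; rewrite /Rintegral.
rewrite (@ae_eq_lower_integral _ _ _ mu setT
  (fun x => (g x : R)%:E) (fun x => (h x : R)%:E)); last first.
  by apply: filterS gh => x /(_ I) ->.
rewrite (@ae_eq_lower_integral _ _ _ mu setT
  (fun x => (`|g x : R|)%:E) (fun x => (`|h x : R|)%:E)); last first.
  by apply: filterS gh => x /(_ I) ->.
apply: (@le_trans _ _ (`|\int[mu]_x (h x : R)%:E|)%E).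
  by case: (integral _ _ _) => [r| |] //=; rewrite normr0 leey.
by apply: (le_abse_integral mu measurableT); exact/measurable_EFinP.
Qed.

Lemma ae_Rintegral_sub_le (g1 g2 : T -> measurableTypeR R) :
  ae_measurable mu g1 -> ae_measurable mu g2 ->
  (\int[mu]_x (`|g1 x : R|)%:E < +oo)%E -> (\int[mu]_x (`|g2 x : R|)%:E < +oo)%E ->
  ((`| \int[mu]_x (g1 x : R) - \int[mu]_x (g2 x : R)|)%:E <=
    \int[mu]_x (`|g1 x - g2 x : R|)%:E)%E.
Proof.
move=> [h1 mh1 gh1] [h2 mh2 gh2] i1 i2.
have int (g h : T -> measurableTypeR R) : measurable_fun setT h -> g = h %[ae mu] ->
    (\int[mu]_x (`|g x : R|)%:E < +oo)%E -> mu.-integrable setT (EFin \o (h : T -> R)).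
  move=> mh gh ig; apply/integrableP; split; first exact/measurable_EFinP.
  rewrite (@ae_eq_lower_integral _ _ _ mu setT _ (fun x => (`|g x : R|)%:E))//.
  by apply: filterS gh => x /(_ I) ->.
have eqR (g h : T -> measurableTypeR R) : g = h %[ae mu] ->
    \int[mu]_x (g x : R) = \int[mu]_x (h x : R).
  move=> gh; rewrite /Rintegral; congr fine.
  by apply: ae_eq_lower_integral; apply: filterS gh => x /(_ I) ->.
rewrite (eqR _ _ gh1) (eqR _ _ gh2) -RintegralB//; last 2 first.
- exact: int gh1 i1.
- exact: int gh2 i2.
rewrite [leRHS](@ae_eq_lower_integral _ _ _ mu setT _ (fun x => (`|h1 x - h2 x : R|)%:E)).
  by apply: ae_abs_Rintegral_le; apply: ae_measurable_fun_ae; exact: measurable_funB.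
by apply: filterS2 gh1 gh2 => x /(_ I) -> /(_ I) ->.
Qed.

(** The factor 2, from treating real and imaginary parts separately, is harmless
    and avoids a rotation of the integral. *)
Lemma cmod_integralC_le (F : T -> R[i]) : ae_measurableC mu F ->
  ((cmod (integralC mu F))%:E <= 2%:E * \int[mu]_x (cmod (F x))%:E)%E.
Proof.
move=> [Fr Fi]; set Z := integralC mu F.
apply: (@le_trans _ _ (`|complex.Re Z|%:E + `|complex.Im Z|%:E)%E).
  by rewrite -EFinD lee_fin cmod_le_ReIm.
rewrite mule_natl mule2n; apply: leeD.
  apply: le_trans (ae_abs_Rintegral_le Fr) _.
  by apply: ge0_le_lower_integral => x _; rewrite lee_fin ?cmod_ge0// le_Re_cmod.
apply: le_trans (ae_abs_Rintegral_le Fi) _.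
by apply: ge0_le_lower_integral => x _; rewrite lee_fin ?cmod_ge0// le_Im_cmod.
Qed.

Lemma cmod_integralC_sub_le (F1 F2 : T -> R[i]) :
  ae_measurableC mu F1 -> ae_measurableC mu F2 ->
  (\int[mu]_x (cmod (F1 x))%:E < +oo)%E -> (\int[mu]_x (cmod (F2 x))%:E < +oo)%E ->
  ((cmod (integralC mu F1 - integralC mu F2))%:E <=
   2%:E * \int[mu]_x (cmod (F1 x - F2 x))%:E)%E.
Proof.
move=> [F1r F1i] [F2r F2i] i1 i2.
have fin (F : T -> R[i]) (p : R[i] -> R) : (forall z, `|p z| <= cmod z) ->
    (\int[mu]_x (cmod (F x))%:E < +oo)%E -> (\int[mu]_x (`|p (F x)|)%:E < +oo)%E.
  move=> pz; apply: le_lt_trans.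
  by apply: ge0_le_lower_integral => x _; rewrite lee_fin ?cmod_ge0.
set Z := integralC mu F1 - integralC mu F2.
apply: (@le_trans _ _ (`|complex.Re Z|%:E + `|complex.Im Z|%:E)%E).
  by rewrite -EFinD lee_fin cmod_le_ReIm.
rewrite mule_natl mule2n; apply: leeD.
  apply: le_trans (ae_Rintegral_sub_le F1r F2r
    (fin _ _ (@le_Re_cmod R) i1) (fin _ _ (@le_Re_cmod R) i2)) _.
  apply: ge0_le_lower_integral => x _; rewrite lee_fin ?cmod_ge0//.
  by apply: le_trans (le_Re_cmod _); case: (F1 x) (F2 x) => ? ? [].
apply: le_trans (ae_Rintegral_sub_le F1i F2i
  (fin _ _ (@le_Im_cmod R) i1) (fin _ _ (@le_Im_cmod R) i2)) _.
apply: ge0_le_lower_integral => x _; rewrite lee_fin ?cmod_ge0//.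
by apply: le_trans (le_Im_cmod _); case: (F1 x) (F2 x) => ? ? [].
Qed.

End complex_integral.

(** * Polynomial decay *)

Section polynomial_decay.
Context (R : realType).

(** exp(u) = exp(u/m)^m >= (1 + u/m)^m with u = s^2/c and m > N, and
    1 + s <= 2(1 + s^2). *)
Lemma expR_gaussian_decay (c : R) (N : nat) : 0 < c ->
  exists2 M : R, 0 < M & forall s, 0 <= s -> expR (- (s ^+ 2 / c)) <= M * (1 + s) ^- N.
Proof.
move=> c0; pose m : R := N.+1%:R; have m0 : 0 < m by rewrite ltr0n.
pose k := 2 * (1 + c * m); have k0 : 0 < k by rewrite mulr_gt0// addr_gt0// mulr_gt0.
exists (k ^+ N); first by rewrite exprn_gt0.
move=> s s0; have s1 : 0 < 1 + s by rewrite ltr_wpDr.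
pose x := s ^+ 2 / c; have x0 : 0 <= x by rewrite divr_ge0 ?sqr_ge0// ltW.
have y0 : 0 <= x / m by rewrite divr_ge0// ltW.
rewrite -/x expRN -[leRHS]invrK lef_pV2 ?posrE ?expR_gt0//; last first.
  by rewrite invr_gt0 mulr_gt0 ?invr_gt0 ?exprn_gt0.
rewrite invfM invrK.
apply: (@le_trans _ _ ((1 + x / m) ^+ N)); last first.
  apply: (@le_trans _ _ ((1 + x / m) ^+ N.+1)).
    by rewrite ler_weXn2l// lerDl.
  have xE : x = N.+1%:R * (x / m) by rewrite mulrC mulfVK// gt_eqF.
  rewrite [in leRHS]xE expRM_natl lerXn2r ?nnegrE ?expR_ge0 ?addr_ge0//.
  exact: expR_ge1Dx.
rewrite -exprVn -exprMn; apply: lerXn2r; rewrite ?nnegrE.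
- by apply: mulr_ge0; [rewrite invr_ge0 ltW|exact: ltW].
- by rewrite addr_ge0.
rewrite ler_pdivrMl//.
have -> : k * (1 + x / m) = 2 * (1 + c * m + x / m + s ^+ 2).
  rewrite /k /x; field; rewrite !gt_eqF//.
have h1 : s * 2 <= s ^+ 2 + 1.
  by rewrite -subr_ge0 (_ : _ - _ = (s - 1) ^+ 2) ?sqr_ge0//; ring.
have h2 : 0 < c * m by rewrite mulr_gt0.
have h3 : 0 <= s ^+ 2 by exact: sqr_ge0.
move: h1 h2 h3 y0; move: (s ^+ 2) (c * m) (x / m) => a b e; lra.
Qed.

Context (n : nat).
Implicit Types x y z : Rn R n.

(** The quantity 1 + |x - y|/t. Its powers replace Gaussians throughout: they
    are submultiplicative along x, y, z ([rel_distM]), so a weight centred at x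
    can be transferred to y. *)
Definition rel_dist x y (t : R) : R := 1 + eucl_dist x y / t.

Lemma rel_dist_ge1 x y t : 0 < t -> 1 <= rel_dist x y t.
Proof. by move=> t0; rewrite lerDl divr_ge0 ?eucl_dist_ge0// ltW. Qed.

Lemma rel_dist_gt0 x y t : 0 < t -> 0 < rel_dist x y t.
Proof. by move=> /(rel_dist_ge1 x y); exact: lt_le_trans. Qed.

Lemma rel_distM x y z t : 0 < t ->
  rel_dist x z t <= rel_dist x y t * rel_dist y z t.
Proof.
move=> t0; rewrite /rel_dist.
have h : eucl_dist x z / t <= eucl_dist x y / t + eucl_dist y z / t.
  by rewrite -mulrDl ler_pM2r ?invr_gt0// eucl_dist_triangle.
have h1 : 0 <= eucl_dist x y / t by rewrite divr_ge0 ?eucl_dist_ge0// ltW.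
have h2 : 0 <= eucl_dist y z / t by rewrite divr_ge0 ?eucl_dist_ge0// ltW.
by nra.
Qed.

Lemma measurable_rel_dist x t : measurable_fun setT (fun y => rel_dist x y t).
Proof.
apply: measurable_funD => //; apply: measurable_funM => //.
rewrite (_ : eucl_dist x = fun y => eucl_dist y x); first exact: measurable_eucl_dist.
by apply/funext => y; rewrite eucl_distC.
Qed.

Lemma rel_dist_exprV_ge0 x y t N : 0 < t -> 0 <= rel_dist x y t ^- N.
Proof. by move=> t0; rewrite invr_ge0 exprn_ge0// ltW// rel_dist_gt0. Qed.

Lemma measurable_rel_dist_exprV x t N : 0 < t ->
  measurable_fun setT (fun y => rel_dist x y t ^- N).
Proof.
move=> t0; rewrite (_ : (fun y => _) = (fun y => rel_dist x y t `^ (- N%:R))).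
  apply: (measurableT_comp (f := fun u : R => (u `^ (- N%:R))%R)).
    exact: measurable_powR.
  exact: measurable_rel_dist.
by apply/funext => y; rewrite powR_invn// ltW// rel_dist_gt0.
Qed.

(** Compare with the first ball of radius 2^k t around [x] that contains [y]. *)
Lemma rel_dist_exprV_le_series x y t : 0 < t ->
  ((rel_dist x y t ^- n.+1)%:E <=
  \sum_(k <oo) (2 ^+ n.+1 * 2 ^- (k * n.+1) * \1_(eucl_ball x (2 ^+ k * t)) y)%:E)%E.
Proof.
move=> t0; have D0 := rel_dist_gt0 x y t0.
have exk : exists k, eucl_dist x y / t < 2 ^+ k.
  have [k kr] := expn2_unbounded (eucl_dist x y / t + 1); exists k.
  by apply: lt_le_trans kr; rewrite ltrDl.
pose F k := 2 ^+ n.+1 * 2 ^- (k * n.+1) * \1_(eucl_ball x (2 ^+ k * t)) y : R.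
have F0 k : 0 <= F k by rewrite !mulr_ge0.
have [k kd kmin] := ex_minnP exk.
apply: (@le_trans _ _ (F k)%:E); last first.
  have := @nneseries_lim_ge _ (fun j => (F j)%:E) xpredT 0 k.+1 (fun j _ _ => F0 j).
  apply: le_trans; rewrite big_nat_recr//= leeDr// sume_ge0// => i _.
  by rewrite lee_fin.
rewrite lee_fin /F indicE mem_set ?mulr1; last first.
  by rewrite /eucl_ball/= eucl_distC -ltr_pdivrMr.
case: k kd kmin => [|k] kd kmin.
  rewrite mul0n expr0 invr1 mulr1; apply: (@le_trans _ _ 1).
    by rewrite invf_le1 ?exprn_gt0// exprn_ege1// rel_dist_ge1.
  by rewrite exprn_ege1// ler1n.
have kd' : 2 ^+ k <= eucl_dist x y / t.
  by rewrite leNgt; apply/negP => /kmin; rewrite ltnn.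
have -> : 2 ^- (k.+1 * n.+1) = (2 ^- k.+1) ^+ n.+1 :> R by rewrite exprM exprVn.
have -> : rel_dist x y t ^- n.+1 = (rel_dist x y t)^-1 ^+ n.+1 by rewrite exprVn.
rewrite -exprMn; apply: lerXn2r; rewrite ?nnegrE.
- by rewrite invr_ge0 ltW.
- by rewrite mulr_ge0// invr_ge0 exprn_ge0.
rewrite (_ : 2 * 2 ^- k.+1 = (2 ^+ k)^-1); last first.
  by rewrite exprS invfM mulrA mulfV ?mul1r// pnatr_eq0.
rewrite lef_pV2 ?posrE ?exprn_gt0//.
by apply: le_trans kd' _; rewrite lerDr.
Qed.

(** The exponent n + 1 beats the growth (2^k t)^n of the balls by 2^-k. *)
Lemma integral_rel_dist_exprV : (0 < n)%N -> exists2 C : R, 0 < C &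
  forall x t, 0 < t ->
    (\int[lebesgue_rn R n]_y (rel_dist x y t ^- n.+1)%:E <= (C * t ^+ n)%:E)%E.
Proof.
move=> n0; exists (2 ^+ n.+1 * 2 ^+ n * 2); first by rewrite !mulr_gt0 ?exprn_gt0.
move=> x t t0.
pose F k y := (2 ^+ n.+1 * 2 ^- (k * n.+1) * \1_(eucl_ball x (2 ^+ k * t)) y)%:E : \bar R.
have F0 k y : (0 <= F k y)%E by rewrite lee_fin !mulr_ge0.
apply: (@le_trans _ _ (\int[lebesgue_rn R n]_y (\sum_(k <oo) F k y))%E).
  apply: ge0_le_lower_integral => y _.
  - by rewrite lee_fin rel_dist_exprV_ge0.
  - by apply: nneseries_ge0.
  - exact: rel_dist_exprV_le_series.
have mB k : measurable (eucl_ball x (2 ^+ k * t)) by exact: measurable_eucl_ball.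
rewrite integral_nneseries//; last first.
  by move=> k; apply/measurable_EFinP; apply: measurable_funM => //.
apply: lime_le; first by apply: is_cvg_nneseries => k _ _; exact: integral_ge0.
apply: nearW => J.
apply: (@le_trans _ _ (\sum_(0 <= k < J)
    (2 ^+ n.+1 * 2 ^+ n * t ^+ n * 2 * (2 ^- k - 2 ^- k.+1))%:E)%E).
  apply: lee_sum => k _; rewrite /F.
  under eq_integral do rewrite EFinM.
  rewrite ge0_integralZl//; last exact/measurable_EFinP.
  rewrite integral_indic// setIT.
  have kt0 : 0 < 2 ^+ k * t by rewrite mulr_gt0// exprn_gt0.
  have /andP[_ h2] := lebesgue_ball_bounds x n0 kt0.
  apply: le_trans (lee_wpmul2l _ h2) _; first by rewrite lee_fin mulr_ge0.
  rewrite -EFinM lee_fin le_eqVlt; apply/orP; left; apply/eqP.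
  have p2 : 2 ^+ k != 0 :> R by rewrite expf_neq0// pnatr_eq0.
  have -> : 2 ^- k - 2 ^- k.+1 = 2 ^- k / 2 :> R by rewrite exprS; field.
  rewrite exprMn mulnS exprD exprM [2 ^+ n.+1]exprS.
  by field; rewrite p2 expf_neq0.
rewrite sumEFin lee_fin -mulr_sumr.
rewrite (_ : 2 ^+ n.+1 * 2 ^+ n * 2 * t ^+ n = 2 ^+ n.+1 * 2 ^+ n * t ^+ n * 2 * 1); last by ring.
rewrite ler_wpM2l//; first by rewrite !mulr_ge0// exprn_ge0// ltW.
rewrite (eq_bigr (fun k => - (2 ^- k.+1 - 2 ^- k))); last by move=> k _; rewrite opprB.
rewrite sumrN telescope_sumr// opprB expr0 invr1 lerBlDr lerDl invr_ge0 exprn_ge0//.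
Qed.

End polynomial_decay.

(** * Estimates of the kernels *)

(** The product measure of a set is the integral of the measures of its
    sections, so that almost all of them are null when it is. *)
Lemma ae_xsection (R : realType) d1 d2 (T1 : measurableType d1) (T2 : measurableType d2)
    (m1 : {measure set T1 -> \bar R}) (m2 : {sigma_finite_measure set T2 -> \bar R})
    (P : T1 * T2 -> Prop) :
  (\forall p \ae (m1 \x m2)%E, P p) ->
  \forall x \ae m1, \forall y \ae m2, P (x, y).
Proof.
move=> [N [mN N0 PN]].
have mphi : measurable_fun setT (fun x => m2 (xsection N x)).
  exact: measurable_fun_xsection.
have : (\int[m1]_x `|m2 (xsection N x)| = 0)%E.
  under eq_integral do rewrite gee0_abs//.
  exact: N0.
move/(ae_eq_integral_abs m1 measurableT mphi) => H.
apply: filterS H => x /(_ I) Nx.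
exists (xsection N x); split => //; first exact: measurable_xsection.
by move=> y /= Py; rewrite /xsection/= inE; apply: PN.
Qed.

Section kernel_estimates.
Context (R : realType) (n : nat).
Variable K : R -> Rn R n -> Rn R n -> R[i].
Hypothesis K_gauss : gaussian_bound K.
Hypothesis K_hoelder : hoelder_kernel K.
Implicit Types x y z : Rn R n.

Let sqr_powR (t : R) : 0 < t -> (t ^+ 2) `^ (n%:R / 2) = t ^+ n.
Proof.
move=> t0; rewrite -powR_mulrn ?(ltW t0)// -powRrM mulrCA divff ?mulr1 ?pnatr_eq0//.
by rewrite powR_mulrn// ltW.
Qed.

Lemma kernel_decay (N : nat) : exists2 M : R, 0 < M & forall t x y, 0 < t ->
  cmod (K (t ^+ 2) x y) <= M * (t ^- n * rel_dist x y t ^- N).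
Proof.
have [_ [C [c [C0 c0 KC]]]] := K_gauss.
have [M M0 MP] := expR_gaussian_decay N c0.
exists (C * M); first exact: mulr_gt0.
move=> t x y t0; apply: le_trans (KC _ x y (exprn_gt0 2 t0)) _.
rewrite sqr_powR// -mulrA -mulrA; apply: ler_wpM2l; first exact: ltW.
rewrite [leRHS]mulrCA; apply: ler_wpM2l; first by rewrite invr_ge0 exprn_ge0// ltW.
have := MP (eucl_dist x y / t); rewrite divr_ge0 ?eucl_dist_ge0 ?(ltW t0)// => /(_ isT).
apply: le_trans; rewrite le_eqVlt; apply/orP; left; apply/eqP.
congr (expR (- _)); rewrite exprMn exprVn; field.
by rewrite !gt_eqF.
Qed.

(** The Hoelder bound is small when [y1] is close to [y2] but does not decay
    in [x]; the Gaussian bound decays but is not small. Their geometric mean is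
    small and decays. *)
Lemma kernel_equicontinuous (N : nat) (eta : R) : 0 < eta ->
  exists2 delta : R, 0 < delta < 1 & forall t x y1 y2, 0 < t ->
    eucl_dist y1 y2 < delta * t ->
    cmod (K (t ^+ 2) y1 x - K (t ^+ 2) y2 x) <=
      eta * (t ^- n * rel_dist y1 x t ^- N).
Proof.
move=> eta0; have [C [m [C0 /andP[m0 _] KC]]] := K_hoelder.
have [M M0 MP] := kernel_decay (N + N).
pose M' := M * (1 + 2 ^+ (N + N)).
have M'0 : 0 < M' by rewrite mulr_gt0// ltr_wpDr// exprn_ge0.
pose e := eta ^+ 2 / (C * M').
have e0 : 0 < e by rewrite divr_gt0 ?exprn_gt0// mulr_gt0.
pose delta := Order.min 2^-1 (e `^ m^-1).
have d0 : 0 < delta by rewrite lt_min invr_gt0 ltr0n powR_gt0.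
have d1 : delta < 1.
  by rewrite gt_min; apply/orP; left; rewrite invf_lt1// ltr1n.
exists delta; first by rewrite d0.
move=> t x y1 y2 t0 y12.
have D10 := rel_dist_gt0 y1 x t0; have D20 := rel_dist_gt0 y2 x t0.
have tn0 : 0 <= t ^- n by rewrite invr_ge0 exprn_ge0// ltW.
set a := cmod _.
have small : a <= C * (t ^- n * delta `^ m).
  apply: le_trans (KC _ x y1 y2 (exprn_gt0 2 t0)) _.
  rewrite sqr_powR// -!mulrA; apply: ler_wpM2l; first exact: ltW.
  apply: ler_wpM2l => //.
  have -> : (t ^+ 2) `^ (m / 2) = t `^ m.
    rewrite -powR_mulrn ?(ltW t0)// -powRrM mulrCA divff ?mulr1 ?pnatr_eq0//.
  rewrite ler_pdivrMr ?powR_gt0// -powRM ?(ltW d0) ?(ltW t0)//.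
  by apply: ge0_ler_powR; rewrite ?nnegrE ?eucl_dist_ge0 ?mulr_ge0 ?(ltW d0)
    ?(ltW t0) ?(ltW m0) ?(ltW y12).
have D12 : rel_dist y1 x t <= 2 * rel_dist y2 x t.
  apply: le_trans (rel_distM y1 y2 x t0) _; apply: ler_wpM2r; first exact: ltW.
  rewrite /rel_dist -[2]/(1 + 1) lerD2l ler_pdivrMr// mul1r.
  by apply: le_trans (ltW y12) _; rewrite ler_piMl// ltW.
have decay : a <= M' * (t ^- n * rel_dist y1 x t ^- (N + N)).
  apply: le_trans (cmodD _ _) _; rewrite cmodN.
  apply: le_trans (lerD (MP _ _ _ t0) (MP _ _ _ t0)) _.
  rewrite -mulrDr /M' -mulrA; apply: ler_wpM2l; first exact: ltW.
  rewrite -mulrDr mulrCA; apply: ler_wpM2l => //.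
  rewrite mulrDl mul1r lerD2l.
  have -> : 2 ^+ (N + N) / rel_dist y1 x t ^+ (N + N) = (2 / rel_dist y1 x t) ^+ (N + N).
    by rewrite exprMn exprVn.
  rewrite -exprVn; apply: lerXn2r; rewrite ?nnegrE ?mulr_ge0 ?invr_ge0 ?(ltW D10) ?(ltW D20)//.
  by rewrite ler_pdivlMr// ler_pdivrMl// mulrC.
have dm : C * M' * delta `^ m <= eta ^+ 2.
  rewrite mulrC -ler_pdivlMr ?mulr_gt0// -/e.
  have -> : e = (e `^ m^-1) `^ m by rewrite -powRrM mulVf ?gt_eqF// powRr1// ltW.
  apply: ge0_ler_powR; rewrite ?nnegrE ?(ltW m0) ?(ltW d0) ?powR_ge0//.
  by rewrite ge_min lexx orbT.
have a0 : 0 <= a by exact: cmod_ge0.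
have DN0 : 0 <= rel_dist y1 x t ^- N by rewrite rel_dist_exprV_ge0.
rewrite -(@ler_pXn2r _ 2)// ?nnegrE//; last by rewrite !mulr_ge0// ltW.
rewrite expr2; apply: le_trans (ler_pM a0 a0 small decay) _.
rewrite [leLHS](_ : _ = C * M' * delta `^ m * (t ^- n * rel_dist y1 x t ^- N) ^+ 2); last first.
  rewrite exprD invfM; ring.
by rewrite [leRHS]exprMn; apply: ler_wpM2r => //; exact: sqr_ge0.
Qed.

End kernel_estimates.

Section kernel_sections.
Context (R : realType) (n : nat).
Hypothesis n_gt0 : (0 < n)%N.
Variable K : R -> Rn R n -> Rn R n -> R[i].
Hypothesis K_gauss : gaussian_bound K.
Hypothesis K_hoelder : hoelder_kernel K.
Implicit Types x y z : Rn R n.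

Lemma ae_measurable_section (F : Rn R n * Rn R n -> measurableTypeR R) :
  ae_measurable (lebesgue_rn R n \x lebesgue_rn R n)%E F ->
  \forall x \ae lebesgue_rn R n, ae_measurable (lebesgue_rn R n) (fun y => F (x, y)).
Proof.
move=> [G mG FG].
have H : \forall x \ae lebesgue_rn R n, \forall y \ae lebesgue_rn R n, F (x, y) = G (x, y).
  by apply: (ae_xsection (P := fun p => F p = G p)); apply: filterS FG => p; exact.
apply: filterS H.
move=> x Fx; exists (fun y => G (x, y)); last by apply: filterS Fx.
by apply: measurableT_comp => //; exact: measurable_pair1.
Qed.

(** Joint measurability gives this for almost every [x] only. Such points are
    dense, and the Hoelder bound makes the section at any [x] a pointwise limit
    of good sections. *)
Lemma ae_measurable_kernel (t : R) x : 0 < t ->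
  ae_measurableC (lebesgue_rn R n) (K (t ^+ 2) x).
Proof.
move=> t0; have t20 : 0 < t ^+ 2 by rewrite exprn_gt0.
have [/(_ _ t20)[Kr Ki] _] := K_gauss.
have good : \forall z \ae lebesgue_rn R n, ae_measurableC (lebesgue_rn R n) (K (t ^+ 2) z).
  by apply: filterS2 (ae_measurable_section Kr) (ae_measurable_section Ki) => z.
have /choice[xs xsP] : forall k, exists z, eucl_dist z x < k.+1%:R^-1 /\
    ae_measurableC (lebesgue_rn R n) (K (t ^+ 2) z).
  move=> k; have k0 : 0 < k.+1%:R^-1 :> R by rewrite invr_gt0 ltr0n.
  have [m m0 mE] := lebesgue_ball_fin n_gt0 x k0.
  have [|z zx zg] := @ae_exists _ _ _ (lebesgue_rn R n)
      (eucl_ball x k.+1%:R^-1) _ (measurable_eucl_ball _ _) _ good.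
    by rewrite [X in (_ < X)%E](_ : _ = m%:E)// lte_fin.
  by exists z.
have cvgK y (p : R[i] -> R) : (forall u, `|p u| <= cmod u) ->
    (forall u1 u2, p (u1 - u2) = p u1 - p u2) ->
    p (K (t ^+ 2) (xs k) y) @[k --> \oo] --> p (K (t ^+ 2) x y).
  move=> p1 pB; apply/cvgrPdist_le => /= e e0.
  have e'0 : 0 < e * t ^+ n by rewrite mulr_gt0// exprn_gt0.
  have [delta /andP[d0 d1] dP] := @kernel_equicontinuous R n K K_gauss K_hoelder 0 _ e'0.
  have dt0 : 0 < delta * t by rewrite mulr_gt0.
  have := near_infty_natSinv_lt (PosNum dt0); apply: filterS => k /= kd.
  rewrite -pB; apply: le_trans (p1 _) _.
  have := dP t y x (xs k) t0; rewrite eucl_distC => /(_ (lt_trans (xsP k).1 kd)) /le_trans; apply.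
  by rewrite expr0 invr1 mulr1 -mulrA divff ?mulr1// expf_neq0// gt_eqF.
split.
  apply: (@ae_measurable_cvg _ _ _ _ (fun k y => complex.Re (K (t ^+ 2) (xs k) y))).
    by move=> k; have [_ []] := xsP k.
  move=> y; apply: (cvgK _ (@complex.Re R)); first exact: le_Re_cmod.
  by move=> [? ?] [? ?].
apply: (@ae_measurable_cvg _ _ _ _ (fun k y => complex.Im (K (t ^+ 2) (xs k) y))).
  by move=> k; have [_ []] := xsP k.
move=> y; apply: (cvgK _ (@complex.Im R)); first exact: le_Im_cmod.
by move=> [? ?] [? ?].
Qed.

End kernel_sections.

(** * The operators given by the kernels *)

Section kernel_operator.
Context (R : realType) (n : nat).
Hypothesis n_gt0 : (0 < n)%N.
Variable K : R -> Rn R n -> Rn R n -> R[i].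
Hypothesis K_gauss : gaussian_bound K.
Hypothesis K_hoelder : hoelder_kernel K.
Implicit Types (x y z : Rn R n) (f : Rn R n -> R[i]).

Lemma L2_sqr_integral f : L2 f ->
  (\int[lebesgue_rn R n]_x (cmod (f x) ^+ 2)%:E < +oo)%E.
Proof.
move=> [_]; rewrite /L2norm unlock.
have -> : (\int[lebesgue_rn R n]_x (`|(EFin \o (@cmod R \o f)) x| `^ 2) =
   \int[lebesgue_rn R n]_x (cmod (f x) ^+ 2)%:E)%E.
  apply: eq_integral => x _ /=.
  by rewrite ger0_norm ?cmod_ge0// powR_mulrn// cmod_ge0.
move=> H; rewrite ltey; apply/eqP => E; move: H.
by rewrite E poweRyr// invr_neq0// pnatr_eq0.
Qed.

Lemma ae_measurable_cmod_version f : L2 f ->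
  exists g : Rn R n -> R, [/\ measurable_fun setT g, forall x, 0 <= g x &
    \forall x \ae lebesgue_rn R n, cmod (f x) = g x].
Proof.
move=> [[[a ma fa] [b mb fb]] _].
exists (fun x => Num.sqrt ((a x : R) ^+ 2 + (b x : R) ^+ 2)); split => [|x|].
- apply: (@measurableT_comp _ _ _ _ _ _ (@Num.sqrt R)).
    by apply: continuous_measurable_fun; exact: sqrt_continuous.
  by apply: measurable_funD; apply: measurable_funX.
- exact: sqrtr_ge0.
- by apply: filterS2 fa fb => x /(_ I) <- /(_ I) <-; case: (f x).
Qed.

(** a b <= a^2 + b^2 is enough: only finiteness and the growth as t tends to 0
    matter, so A may depend on [f]. *)
Lemma L2_average_bound f : L2 f -> exists2 A : R, 0 < A & forall t x, 0 < t ->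
  (\int[lebesgue_rn R n]_y (t ^- n * rel_dist x y t ^- n.+1 * cmod (f y))%:E
    <= (A * (1 + t ^- n))%:E)%E.
Proof.
move=> fL2; have [C C0 CP] := @integral_rel_dist_exprV R n n_gt0.
have [g [mg g0 fg]] := ae_measurable_cmod_version fL2.
have f2 := L2_sqr_integral fL2.
pose F := fine (\int[lebesgue_rn R n]_x (cmod (f x) ^+ 2)%:E).
have i0 : (0 <= \int[lebesgue_rn R n]_x (cmod (f x) ^+ 2)%:E)%E.
  by apply: integral_ge0 => x _; rewrite lee_fin sqr_ge0.
have FE : (\int[lebesgue_rn R n]_x (cmod (f x) ^+ 2)%:E = F%:E)%E.
  by rewrite fineK// ge0_fin_numE.
have F0 : 0 <= F by rewrite -lee_fin -FE.
exists (C + F); first by rewrite ltr_wpDr.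
move=> t x t0; have tn0 : 0 < t ^- n by rewrite invr_gt0 exprn_gt0.
have D0 y : 0 <= rel_dist x y t ^- n.+1 by exact: rel_dist_exprV_ge0.
have mD := measurable_rel_dist_exprV x n.+1 t0.
apply: (@le_trans _ _ (\int[lebesgue_rn R n]_y
    ((t ^- n * t ^- n)%:E * (rel_dist x y t ^- n.+1)%:E + (g y ^+ 2)%:E))%E).
  apply: ge0_ae_le_integral => [y|y|].
  - by rewrite lee_fin !mulr_ge0 ?cmod_ge0 ?(ltW tn0).
  - by rewrite -EFinM -EFinD lee_fin addr_ge0 ?sqr_ge0// !mulr_ge0 ?(ltW tn0).
  - apply: filterS fg => y fgy; rewrite fgy -EFinM -EFinD lee_fin.
    have D1 : rel_dist x y t ^- n.+1 <= 1.
      by rewrite invf_le1 ?exprn_gt0 ?rel_dist_gt0// exprn_ege1// rel_dist_ge1.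
    have := D0 y; have := g0 y.
    move: (rel_dist x y t ^- n.+1) (g y) (t ^- n) tn0 D1 => a b s s0 a1 b0 a0.
    apply: (@le_trans _ _ ((s * a) ^+ 2 + b ^+ 2)).
      have h : 0 <= (s * a - b) ^+ 2 by exact: sqr_ge0.
      have h2 : 0 <= s * a * b by rewrite !mulr_ge0// ltW.
      rewrite -subr_ge0 (_ : _ - _ = (s * a - b) ^+ 2 + s * a * b); last by ring.
      exact: addr_ge0.
    rewrite lerD2r exprMn expr2 ler_wpM2l ?mulr_ge0 ?(ltW s0)//.
    by rewrite expr2 ler_piMr.
rewrite ge0_integralD//; last 4 first.
- by move=> y _; rewrite -EFinM lee_fin !mulr_ge0 ?(ltW tn0).
- by apply: measurable_funeM; exact/measurable_EFinP.
- by move=> y _; rewrite lee_fin sqr_ge0.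
- by apply/measurable_EFinP; exact: measurable_funX.
rewrite ge0_integralZl//; last 3 first.
- exact/measurable_EFinP.
- by move=> y _; rewrite lee_fin.
- by rewrite lee_fin mulr_ge0// ltW.
rewrite (_ : \int[_]_x (g x ^+ 2)%:E = F%:E)%E; last first.
  rewrite -FE; apply: ge0_ae_eq_lower_integral => [y|y|].
  - by rewrite lee_fin sqr_ge0.
  - by rewrite lee_fin sqr_ge0.
  - by apply: filterS fg => y ->.
apply: (@le_trans _ _ ((t ^- n * t ^- n)%:E * (C * t ^+ n)%:E + F%:E)%E).
  by apply: leeD => //; apply: lee_wpmul2l; [rewrite lee_fin mulr_ge0// ltW|exact: CP].
rewrite -EFinM -EFinD lee_fin (_ : t ^- n * t ^- n * (C * t ^+ n) = C * t ^- n); last first.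
  by field; rewrite expf_neq0// gt_eqF.
by move: (t ^- n) tn0 => s s0; nra.
Qed.

Lemma kernel_integral_fin f t x : 0 < t -> L2 f ->
  ae_measurableC (lebesgue_rn R n) (fun y => K (t ^+ 2) x y * f y) /\
  (\int[lebesgue_rn R n]_y (cmod (K (t ^+ 2) x y * f y))%:E < +oo)%E.
Proof.
move=> t0 fL2; split.
  by apply: ae_measurableCM; [exact: ae_measurable_kernel|case: fL2].
have [M M0 MP] := kernel_decay K_gauss n.+1.
have [A A0 AP] := L2_average_bound fL2.
apply: (@le_lt_trans _ _ (M%:E * (A * (1 + t ^- n))%:E)%E); last by rewrite -EFinM ltry.
apply: le_trans (lee_wpmul2l _ (AP _ x t0)); last by rewrite lee_fin ltW.
apply: le_trans (ge0_lower_integralZl_le _ M0 _); last first.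
  by move=> y; rewrite lee_fin !mulr_ge0 ?cmod_ge0 ?rel_dist_exprV_ge0// invr_ge0 exprn_ge0// ltW.
apply: ge0_le_lower_integral => y _.
- by rewrite lee_fin cmod_ge0.
- by rewrite -EFinM lee_fin !mulr_ge0 ?cmod_ge0 ?rel_dist_exprV_ge0
    ?(ltW M0)// invr_ge0 exprn_ge0// ltW.
by rewrite cmodM -EFinM lee_fin mulrA ler_wpM2r ?cmod_ge0// MP.
Qed.

(** The blow-up at t = 0 is at most t^-n, which the factor (t/(t + t0))^n in
    [fefferman_stein] compensates. *)
Lemma kernel_op_bound f : L2 f -> exists2 A : R, 0 < A & forall t y, 0 < t ->
  cmod (kernel_op K (t ^+ 2) f y) <= A * (1 + t ^- n).
Proof.
move=> fL2; have [M M0 MP] := kernel_decay K_gauss n.+1.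
have [A A0 AP] := L2_average_bound fL2.
exists (2 * (M * A)); first by rewrite !mulr_gt0.
move=> t y t0; have [mKf _] := kernel_integral_fin y t0 fL2.
rewrite -lee_fin; apply: le_trans (cmod_integralC_le mKf) _.
rewrite -mulrA -mulrA EFinM; apply: lee_wpmul2l => //.
rewrite EFinM; apply: le_trans (lee_wpmul2l _ (AP _ y t0)); last by rewrite lee_fin ltW.
apply: le_trans (ge0_lower_integralZl_le _ M0 _); last first.
  by move=> z; rewrite lee_fin !mulr_ge0 ?cmod_ge0 ?rel_dist_exprV_ge0// invr_ge0 exprn_ge0// ltW.
apply: ge0_le_lower_integral => z _.
- by rewrite lee_fin cmod_ge0.
- by rewrite -EFinM lee_fin !mulr_ge0 ?cmod_ge0 ?rel_dist_exprV_ge0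
    ?(ltW M0)// invr_ge0 exprn_ge0// ltW.
by rewrite cmodM -EFinM lee_fin mulrA ler_wpM2r ?cmod_ge0// MP.
Qed.

(** The regularity of the kernel passes to the operators: the oscillation at
    scale delta t is eta times an average at scale t. *)
Lemma kernel_op_oscillation (N : nat) (eta : R) : 0 < eta ->
  exists2 delta : R, 0 < delta < 1 & forall f t y1 y2, L2 f -> 0 < t ->
    eucl_dist y1 y2 < delta * t ->
    ((cmod (kernel_op K (t ^+ 2) f y1 - kernel_op K (t ^+ 2) f y2))%:E <=
      (2 * eta)%:E * \int[lebesgue_rn R n]_z
        (t ^- n * rel_dist y1 z t ^- N * cmod (f z))%:E)%E.
Proof.
move=> eta0; have [delta d01 dP] := kernel_equicontinuous K_gauss K_hoelder N eta0.
exists delta => // f t y1 y2 fL2 t0 y12.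
have [m1 i1] := kernel_integral_fin y1 t0 fL2.
have [m2 i2] := kernel_integral_fin y2 t0 fL2.
apply: le_trans (cmod_integralC_sub_le m1 m2 i1 i2) _.
rewrite EFinM -muleA; apply: lee_wpmul2l => //.
apply: le_trans (ge0_lower_integralZl_le _ eta0 _); last first.
  by move=> z; rewrite lee_fin !mulr_ge0 ?cmod_ge0 ?rel_dist_exprV_ge0// invr_ge0 exprn_ge0// ltW.
apply: ge0_le_lower_integral => z _.
- by rewrite lee_fin cmod_ge0.
- by rewrite -EFinM lee_fin !mulr_ge0 ?cmod_ge0 ?rel_dist_exprV_ge0
    ?(ltW eta0)// invr_ge0 exprn_ge0// ltW.
by rewrite -mulrBl cmodM -EFinM lee_fin mulrA ler_wpM2r ?cmod_ge0// dP.
Qed.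

Lemma kernel_op_continuous f t y (e : R) : L2 f -> 0 < t -> 0 < e ->
  exists2 r : R, 0 < r & forall z, eucl_dist z y < r ->
    cmod (kernel_op K (t ^+ 2) f y - kernel_op K (t ^+ 2) f z) <= e.
Proof.
move=> fL2 t0 e0; have [A A0 AP] := L2_average_bound fL2.
pose B := A * (1 + t ^- n).
have B0 : 0 < B by rewrite mulr_gt0// ltr_wpDr// invr_ge0 exprn_ge0// ltW.
have eta0 : 0 < e / (2 * B) by rewrite divr_gt0// mulr_gt0.
have [delta /andP[d0 _] dP] := kernel_op_oscillation n.+1 eta0.
exists (delta * t); first exact: mulr_gt0.
move=> z; rewrite eucl_distC => zy; rewrite -lee_fin; apply: le_trans (dP _ _ _ _ fL2 t0 zy) _.
apply: le_trans (lee_wpmul2l _ (AP _ y t0)) _; first by rewrite lee_fin mulr_ge0// ltW.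
rewrite -/B -EFinM lee_fin le_eqVlt; apply/orP; left; apply/eqP.
by field; rewrite gt_eqF.
Qed.

(** A supremum of functions continuous in [x], over an arbitrary set of [t], is
    lower semicontinuous, hence Borel. *)
Lemma measurable_radial_max f : L2 f -> measurable_fun setT (radial_max K f).
Proof.
move=> fL2; apply: lower_semicontinuous_measurable => // a x /ereal_sup_gt[_ [t /= t0 <-]].
rewrite lte_fin => au.
have e0 : 0 < (cmod (kernel_op K (t ^+ 2) f x) - a) / 2 by rewrite divr_gt0// subr_gt0.
have [r r0 rP] := kernel_op_continuous x fL2 t0 e0.
exists r => // y /rP xy; apply: (@lt_le_trans _ _ (cmod (kernel_op K (t ^+ 2) f y))%:E).
  rewrite lte_fin.
  have := cmodD (kernel_op K (t ^+ 2) f x - kernel_op K (t ^+ 2) f y) (kernel_op K (t ^+ 2) f y).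
  rewrite subrK; move: xy e0; move: (cmod _) (cmod _) (cmod _) au => u v w; lra.
by apply: ereal_sup_ubound; exists t.
Qed.

Lemma measurable_nontangential_max f : measurable_fun setT (nontangential_max K f).
Proof.
apply: lower_semicontinuous_measurable => // a x /ereal_sup_gt[_ [y [t [t0 yx ->]]] au].
exists (t - eucl_dist y x); first by rewrite subr_gt0.
move=> z zx; apply: lt_le_trans au _; apply: ereal_sup_ubound; exists y, t; split => //.
apply: le_lt_trans (eucl_dist_triangle x _ _) _.
by rewrite (eucl_distC x z) -ltrBrDl.
Qed.

Lemma radial_max_le f x : (radial_max K f x <= nontangential_max K f x)%E.
Proof.
apply: ge_ereal_sup => _ [t /= t0 <-]; apply: ereal_sup_ubound.
by exists x, t; rewrite eucl_distxx.
Qed.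

(** The semigroup law of [T] is an identity between classes of functions, so
    it holds almost everywhere; here both sides are continuous, hence it holds
    at every point. *)
Lemma kernel_op_semigroup T f (tau s t : R) x :
  C0_semigroup T -> has_kernels T K -> L2 f ->
  0 < tau -> 0 < s -> 0 < t -> tau ^+ 2 = s ^+ 2 + t ^+ 2 ->
  kernel_op K (tau ^+ 2) f x = kernel_op K (s ^+ 2) (T (t ^+ 2) f) x.
Proof.
move=> sgT TK fL2 tau0 s0 t0 tauE.
have s20 : 0 < s ^+ 2 by rewrite exprn_gt0.
have t20 : 0 < t ^+ 2 by rewrite exprn_gt0.
have gL2 : L2 (T (t ^+ 2) f) by exact: semigroup_L2.
have aeq : \forall y \ae lebesgue_rn R n,
    kernel_op K (tau ^+ 2) f y = kernel_op K (s ^+ 2) (T (t ^+ 2) f) y.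
  have h1 := TK _ _ (exprn_gt0 2 tau0) fL2.
  have h2 := TK _ _ s20 gL2.
  have h3 := semigroupD sgT s20 t20 fL2; rewrite -tauE in h3.
  by apply: filterS3 h1 h2 h3 => y /(_ I) <- /(_ I) <- /(_ I).
apply/eqP; rewrite -subr_eq0; apply/eqP; apply: Normc.eq0_normc.
set w := _ - _; apply/eqP; rewrite eq_le cmod_ge0 andbT leNgt; apply/negP => w0.
have e0 : 0 < cmod w / 3 by rewrite divr_gt0.
have [r1 r10 P1] := kernel_op_continuous x fL2 tau0 e0.
have [r2 r20 P2] := kernel_op_continuous x gL2 s0 e0.
have r0 : 0 < Order.min r1 r2 by rewrite lt_min r10.
have [m m0 mE] := lebesgue_ball_fin n_gt0 x r0.
have [|y yx yE] := @ae_exists _ _ _ (lebesgue_rn R n) (eucl_ball x (Order.min r1 r2)) _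
    (measurable_eucl_ball _ _) _ aeq.
  by rewrite [X in (_ < X)%E](_ : _ = m%:E)// lte_fin.
move: yx; rewrite /eucl_ball /= lt_min => /andP[/P1 y1 /P2 y2].
have : cmod w <= cmod w / 3 + cmod w / 3.
  apply: le_trans (lerD y1 y2); rewrite -[X in _ <= _ + X]cmodN.
  apply: le_trans (cmodD _ _); rewrite yE; rewrite /w.
  by rewrite opprB addrA subrK.
by move: (cmod w) w0 => u u0; lra.
Qed.

End kernel_operator.

(** * Spreading of large values of the semigroup *)

Section fefferman_stein.
Context (R : realType) (n : nat).
Hypothesis n_gt0 : (0 < n)%N.
Variable K : R -> Rn R n -> Rn R n -> R[i].
Variable T : R -> (Rn R n -> R[i]) -> (Rn R n -> R[i]).
Hypothesis K_gauss : gaussian_bound K.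
Hypothesis K_hoelder : hoelder_kernel K.
Hypothesis T_semigroup : C0_semigroup T.
Hypothesis T_kernels : has_kernels T K.
Implicit Types (x y z : Rn R n) (f : Rn R n -> R[i]).

(** A large value of u(t, y) = |exp(-t^2 L) f (y)| spreads over a ball. Consider
    the supremum S of u(t, y) e(t) / (1 + |x - y|/t)^N, where the factor
    e(t) = (t/(t + t0))^n makes S finite, and choose (t, y) with at least half of
    S. Write exp(-t^2 L) = exp(-s^2 L) exp(-s^2 L) with s = t/sqrt 2. On a small
    ball around y the function u(t, .) then varies by at most eta times a
    weighted average of u(s, .), and u(s, .) is itself bounded by S times the
    weight. As e and the weight change by bounded factors from t to s and from
    x to y, a small eta makes this variation, in units of the weight over e, at
    most S/4, whereas u(t, y) exceeds S/2
    in the same units. The constants do not depend on t0. *)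
Lemma fefferman_stein (N : nat) : exists2 delta : R, 0 < delta < 1 &
  forall f x (a : R), L2 f -> 0 < a -> (a%:E < nontangential_max K f x)%E ->
  exists y t, 0 < t /\ forall z, eucl_dist z y < delta * t ->
    a * 2 ^- (n + N + 2) * rel_dist x y t ^+ N <= cmod (kernel_op K (t ^+ 2) f z).
Proof.
have [C C0 CP] := @integral_rel_dist_exprV R n n_gt0.
(* The value for which 2 eta C 2^(N+n) = 1/4 in the estimate of [diff]. *)
pose eta := (8 * (C * 2 ^+ (N + n)))^-1.
have eta0 : 0 < eta by rewrite invr_gt0 !mulr_gt0// exprn_gt0.
have [delta /andP[d0 d1] dP] := kernel_op_oscillation n_gt0 K_gauss K_hoelder (N + n.+1) eta0.
exists (delta / 2).
  by rewrite divr_gt0//= ltr_pdivrMr// mul1r (lt_trans d1)// ltr1n.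
move=> f x a fL2 a0 /ereal_sup_gt[_ [y0 [t0 [t00 y0x ->]]]]; rewrite lte_fin => au.
pose u t y := cmod (kernel_op K (t ^+ 2) f y).
pose e t := (t / (t + t0)) ^+ n.
pose W t y := rel_dist x y t ^+ N.
have e_gt0 t : 0 < t -> 0 < e t by move=> t1; rewrite exprn_gt0// divr_gt0// addr_gt0.
have e_le1 t : 0 < t -> e t <= 1.
  move=> t1; rewrite exprn_ile1 ?divr_ge0 ?addr_ge0 ?(ltW t1) ?(ltW t00)//.
  by rewrite ler_pdivrMr ?addr_gt0// mul1r lerDl ltW.
have W_ge1 t y : 0 < t -> 1 <= W t y by move=> t1; rewrite exprn_ege1// rel_dist_ge1.
have W_gt0 t y : 0 < t -> 0 < W t y by move=> t1; exact: lt_le_trans (W_ge1 t y t1).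
have u_ge0 t y : 0 <= u t y by exact: cmod_ge0.
pose V := [set r | exists t y, 0 < t /\ r = u t y * e t / W t y].
have [A A0 AP] := kernel_op_bound n_gt0 K_gauss K_hoelder fL2.
have Vub : has_ubound V.
  exists (A * (1 + t0 ^- n)) => _ [t [y [t1 ->]]].
  apply: (@le_trans _ _ (u t y * e t)).
    by rewrite ler_pdivrMr ?W_gt0// ler_peMr ?W_ge1// mulr_ge0// ltW// e_gt0.
  apply: (@le_trans _ _ (A * (1 + t ^- n) * e t)).
    by rewrite ler_wpM2r ?AP// ltW// e_gt0.
  rewrite -mulrA ler_wpM2l ?(ltW A0)// mulrDl mul1r lerD ?e_le1//.
  rewrite -[leRHS]exprVn /e -exprVn -exprMn lerXn2r ?nnegrE.
  - by [].
  - by rewrite mulr_ge0 ?invr_ge0 ?(ltW t1)// divr_ge0 ?addr_ge0 ?(ltW t1) ?(ltW t00).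
  - by rewrite invr_ge0 ltW.
  - rewrite mulrA mulVf ?gt_eqF// mul1r lef_pV2 ?posrE ?addr_gt0//.
    by rewrite lerDr ltW.
have Vsup : has_sup V by split => //; exists (u t0 y0 * e t0 / W t0 y0), t0, y0.
pose S := sup V.
have SP t y : 0 < t -> u t y * e t / W t y <= S.
  by move=> t1; apply: (ub_le_sup Vub); exists t, y.
have Sa : a * 2 ^- (n + N) <= S.
  apply: le_trans (SP t0 y0 t00).
  have -> : e t0 = 2 ^- n.
    rewrite /e -exprVn; congr (_ ^+ _); field.
    by rewrite gt_eqF// addr_gt0.
  rewrite exprD invfM mulrA; apply: ler_pM => //.
  - by rewrite mulr_ge0 ?invr_ge0 ?exprn_ge0// ltW.
  - by rewrite ler_wpM2r ?invr_ge0 ?exprn_ge0// ltW.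
  rewrite lef_pV2 ?posrE ?W_gt0 ?exprn_gt0 ?rel_dist_gt0//.
  rewrite /W; apply: lerXn2r; rewrite ?nnegrE//.
    exact/ltW/rel_dist_gt0.
  rewrite /rel_dist -[2]/(1 + 1) lerD2l ler_pdivrMr// mul1r eucl_distC.
  exact: ltW.
have S0 : 0 < S by apply: lt_le_trans Sa; rewrite mulr_gt0// invr_gt0 exprn_gt0.
have [_ [t [y [t1 ->]]] Vy] := sup_adherent (divr_gt0 S0 (ltr0n _ 2)) Vsup.
rewrite -/S in Vy.
have E0 := e_gt0 t t1; have W0 := W_gt0 t y t1.
have uy : S / 2 * (W t y / e t) < u t y.
  have : S / 2 < u t y * e t / W t y by apply: le_lt_trans Vy; lra.
  by rewrite ltr_pdivlMr// -ltr_pdivrMr// mulrA.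
exists y, t; split => // z zy.
(* s^2 + s^2 = t^2, and s is comparable with t. *)
pose s := t / Num.sqrt 2.
have q2 : 0 < Num.sqrt 2 :> R by rewrite sqrtr_gt0.
have q22 : Num.sqrt 2 ^+ 2 = 2 :> R by rewrite sqr_sqrtr.
have s0 : 0 < s by rewrite divr_gt0.
have ts : t ^+ 2 = s ^+ 2 + s ^+ 2.
  by rewrite /s exprMn exprVn q22; field.
have st : s <= t.
  rewrite -(ler_pXn2r (n := 2))// ?nnegrE ?(ltW s0) ?(ltW t1)//.
  by rewrite ts lerDl sqr_ge0.
have t2s : t <= 2 * s.
  rewrite -(ler_pXn2r (n := 2))// ?nnegrE; last 2 first.
  - exact: ltW.
  - by rewrite mulr_ge0// ltW.
  rewrite ts (_ : (2 * s) ^+ 2 = s ^+ 2 + s ^+ 2 + 2 * s ^+ 2); last by ring.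
  by rewrite lerDl mulr_ge0// sqr_ge0.
have s20 : 0 < s ^+ 2 by rewrite exprn_gt0.
pose g := T (s ^+ 2) f.
have gL2 : L2 g by exact: (semigroup_L2 T_semigroup).
pose B := S * 2 ^+ (N + n) * (W t y / e t).
have B0 : 0 < B.
  by apply: mulr_gt0; [rewrite mulr_gt0// exprn_gt0|exact: divr_gt0].
have gB : \forall w \ae lebesgue_rn R n, cmod (g w) <= B * rel_dist y w s ^+ N.
  have := T_kernels s20 fL2; apply: filterS => w /(_ I) gw; rewrite /g gw -/(u s w).
  have H1 : u s w <= S * (W s w / e s).
    have := SP s w s0; rewrite ler_pdivrMr ?W_gt0// -ler_pdivlMr ?e_gt0//.
    by rewrite mulrA.
  apply: le_trans H1 _; rewrite /B -!mulrA; apply: ler_wpM2l; first exact: ltW.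
  have es : (e s)^-1 <= 2 ^+ n / e t.
    rewrite ler_pdivlMr// ler_pdivrMl ?e_gt0// mulrC /e -exprMn; apply: lerXn2r.
    - by rewrite nnegrE divr_ge0 ?addr_ge0 ?(ltW t1) ?(ltW t00).
    - by rewrite nnegrE mulr_ge0// divr_ge0 ?addr_ge0 ?(ltW s0) ?(ltW t00).
    rewrite ler_pdivrMr ?addr_gt0//.
    rewrite [leRHS](_ : _ = 2 * s * (t + t0) / (s + t0)); last by ring.
    rewrite ler_pdivlMr ?addr_gt0//.
    have : 0 < t * s by exact: mulr_gt0.
    have : t * t0 <= 2 * s * t0 by apply: ler_wpM2r; [exact: ltW|exact: t2s].
    by nra.
  have Ws : W s w <= 2 ^+ N * (W t y * rel_dist y w s ^+ N).
    rewrite /W -!exprMn; apply: lerXn2r; rewrite ?nnegrE.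
    - exact/ltW/rel_dist_gt0.
    - by rewrite !mulr_ge0// ltW// rel_dist_gt0.
    apply: le_trans (rel_distM x y w s0) _; rewrite mulrA ler_wpM2r//.
      exact/ltW/rel_dist_gt0.
    rewrite /rel_dist mulrDr mulr1; apply: lerD; first by rewrite ler1n.
    rewrite mulrCA; apply: ler_wpM2l; first exact: eucl_dist_ge0.
    by rewrite ler_pdivlMr// ler_pdivrMl// mulrC.
  rewrite exprD; apply: le_trans (ler_pM _ _ Ws es) _.
  - exact/ltW/W_gt0.
  - by rewrite invr_ge0 ltW// e_gt0.
  by rewrite le_eqVlt; apply/orP; left; apply/eqP; ring.
have diff : cmod (kernel_op K (t ^+ 2) f y - kernel_op K (t ^+ 2) f z) <= S / 4 * (W t y / e t).
  rewrite !(kernel_op_semigroup n_gt0 K_gauss K_hoelder _ T_semigroup T_kernels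
    fL2 t1 s0 s0 ts) -/g.
  have zy' : eucl_dist y z < delta * s.
    rewrite eucl_distC; apply: lt_le_trans zy _.
    by rewrite -mulrA ler_wpM2l ?(ltW d0)// mulrC ler_pdivrMr// mulrC.
  rewrite -lee_fin; apply: le_trans (dP _ _ _ _ gL2 s0 zy') _.
  apply: (@le_trans _ _ ((2 * eta)%:E * (B * C)%:E)%E); last first.
    rewrite -EFinM lee_fin /eta /B le_eqVlt; apply/orP; left; apply/eqP.
    by field; rewrite !gt_eqF//= exprn_gt0.
  apply: lee_wpmul2l; first by rewrite lee_fin mulr_ge0// ltW.
  have sn0 : 0 < s ^- n by rewrite invr_gt0 exprn_gt0.
  have Bs0 : 0 < B * s ^- n by exact: mulr_gt0.
  apply: (@le_trans _ _ (\int[lebesgue_rn R n]_w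
    ((B * s ^- n)%:E * (rel_dist y w s ^- n.+1)%:E))%E).
    apply: ge0_ae_le_integral => [w|w|].
    - by rewrite lee_fin !mulr_ge0 ?cmod_ge0 ?rel_dist_exprV_ge0// ltW.
    - by rewrite -EFinM lee_fin mulr_ge0 ?rel_dist_exprV_ge0// ltW.
    apply: filterS gB => w gw; rewrite -EFinM lee_fin.
    apply: (@le_trans _ _ (s ^- n * rel_dist y w s ^- (N + n.+1) * (B * rel_dist y w s ^+ N))).
      by apply: ler_wpM2l => //; rewrite mulr_ge0 ?rel_dist_exprV_ge0// ltW.
    rewrite exprD le_eqVlt; apply/orP; left; apply/eqP.
    by field; rewrite !expf_neq0 ?gt_eqF// rel_dist_gt0.
  apply: le_trans (ge0_lower_integralZl_le _ Bs0 _) _.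
    by move=> w; rewrite lee_fin rel_dist_exprV_ge0.
  apply: le_trans (lee_wpmul2l _ (CP y s s0)) _; first by rewrite lee_fin ltW.
  rewrite -EFinM lee_fin le_eqVlt; apply/orP; left; apply/eqP.
  by field; rewrite expf_neq0// gt_eqF.
have uz : S / 4 * (W t y / e t) <= u t z.
  have := cmodD (kernel_op K (t ^+ 2) f y - kernel_op K (t ^+ 2) f z) (kernel_op K (t ^+ 2) f z).
  rewrite subrK -/(u t y) -/(u t z) => H.
  by move: (W t y / e t) uy diff => v; move: (cmod _) (u t y) (u t z) H => c1 c2 c3; lra.
apply: le_trans uz.
rewrite -/(W t y); apply: (@le_trans _ _ (S / 4 * W t y)); last first.
  apply: ler_wpM2l; first by rewrite divr_ge0// ltW.
  by rewrite ler_pdivlMr// ler_piMr// ?e_le1// ltW.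
apply: ler_wpM2r; first exact: ltW.
rewrite exprD invfM mulrA (_ : 2 ^+ 2 = 4 :> R); last by ring.
by apply: ler_wpM2r.
Qed.

End fefferman_stein.

(** * Modulars, quasi-norms and the comparison *)

Section musielak_orlicz.
Context (R : realType) (n : nat).
Variable phi : Rn R n -> R -> R.
Hypothesis phi_mono : forall x (s t : R), 0 <= s -> s <= t -> phi x s <= phi x t.
Hypothesis phi0 : forall x, phi x 0 = 0.
Implicit Types (f g : Rn R n -> \bar R).

Let phi_ge0 x (t : R) : 0 <= t -> 0 <= phi x t.
Proof. by move=> t0; rewrite -(phi0 x); exact: phi_mono. Qed.

Lemma growth_ext_ge0 x (u : \bar R) : (0 <= u)%E -> (0 <= growth_ext phi x u)%E.
Proof. by case: u => [r|//|//]; rewrite !lee_fin; exact: phi_ge0. Qed.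

Lemma le_growth_ext x (u v : \bar R) : (0 <= u)%E -> (u <= v)%E ->
  (growth_ext phi x u <= growth_ext phi x v)%E.
Proof.
case: u v => [r| |] [s| |] //=; rewrite ?leey// !lee_fin.
exact: phi_mono.
Qed.

Let scale_ge0 f (l : R) x : 0 < l -> (0 <= `|f x| * l^-1%:E)%E.
Proof. by move=> l0; rewrite mule_ge0// lee_fin invr_ge0 ltW. Qed.

Lemma le_modular f g (l : R) : 0 < l -> (forall x, (0 <= f x)%E) ->
  (forall x, (f x <= g x)%E) -> (modular phi f l <= modular phi g l)%E.
Proof.
move=> l0 f0 fg; apply: ge0_le_lower_integral => x _.
- by apply: growth_ext_ge0; exact: scale_ge0.
- by apply: growth_ext_ge0; exact: scale_ge0.
apply: le_growth_ext; first exact: scale_ge0.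
apply: lee_wpmul2r; first by rewrite lee_fin invr_ge0 ltW.
by rewrite !gee0_abs// (le_trans (f0 x)).
Qed.

(** An inequality of quasi-norms follows from a dilation of the admissible
    parameters. *)
Lemma le_Lphi_norm f g (c : R) : 0 < c ->
  (forall l, 0 < l -> (modular phi g l <= 1)%E -> (modular phi f (c * l) <= 1)%E) ->
  (Lphi_norm phi f <= c%:E * Lphi_norm phi g)%E.
Proof.
move=> c0 fg; rewrite -lee_pdivrMl//; apply: le_ereal_inf_tmp => _ [l [l0 gl] <-].
rewrite lee_pdivrMl// -EFinM; apply: ereal_inf_lbound; exists (c * l) => //.
by split; [exact: mulr_gt0|exact: fg].
Qed.

Lemma Lphi_norm_ge0 f : (0 <= Lphi_norm phi f)%E.
Proof. by apply: le_ereal_inf_tmp => _ [l [l0 _] <-]; rewrite lee_fin ltW. Qed.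

(** The growth function is infinite at infinity, so a finite modular forces
    finiteness almost everywhere. *)
Lemma modular_fin_num f : measurable_fun setT f -> (modular phi f 1 < +oo)%E ->
  \forall x \ae lebesgue_rn R n, (`|f x| < +oo)%E.
Proof.
move=> mf foo; pose Z := [set x | `|f x|%E = +oo%E].
have mZ : measurable Z.
  rewrite (_ : Z = (abse \o f) @^-1` [set +oo%E]) //.
  rewrite -[X in measurable X]setTI; apply: measurableT_comp => //.
exists Z; split => //; last first.
  by move=> x /= /negP; rewrite -leNgt leye_eq => /eqP.
apply/eqP; rewrite eq_le measure_ge0 andbT leNgt; apply/negP => Z0.
have : (+oo * lebesgue_rn R n Z <= modular phi f 1)%E.
  rewrite -[in leLHS](setIT Z) -integral_indic// -ge0_integralZl//; last exact/measurable_EFinP.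
  apply: ge0_le_lower_integral => x _.
  - by rewrite mule_ge0// lee_fin.
  - by apply: growth_ext_ge0; exact: scale_ge0.
  rewrite indicE; case: (boolP (x \in Z)) => [/set_mem /= ->|_].
    by rewrite invr1 !mule1.
  by rewrite mule0; apply: growth_ext_ge0; exact: scale_ge0.
by rewrite gt0_mulye// leye_eq => /eqP E; move: foo; rewrite E.
Qed.

Variables (p Cl : R).
Hypothesis Cl_gt0 : 0 < Cl.
Hypothesis phi_lower : forall x (t s : R), 0 <= t -> 0 <= s <= 1 ->
    phi x (s * t) <= Cl * s `^ p * phi x t.

(** The lower type turns a dilation of the parameter into a small factor, by
    which a constant in front of a modular can be absorbed. *)
Lemma modular_shrink f (l s : R) : 0 < l -> 0 < s <= 1 ->
  (modular phi f (s^-1 * l) <= (Cl * s `^ p)%:E * modular phi f l)%E.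
Proof.
move=> l0 /andP[s0 s1].
have c0 : 0 < Cl * s `^ p by rewrite mulr_gt0// powR_gt0.
apply: le_trans (ge0_lower_integralZl_le _ c0 _); last first.
  by move=> x; apply: growth_ext_ge0; exact: scale_ge0.
apply: ge0_le_lower_integral => x _.
- by apply: growth_ext_ge0; apply: scale_ge0; rewrite mulr_gt0// invr_gt0.
- rewrite mule_ge0 ?lee_fin ?(ltW c0)//.
  by apply: growth_ext_ge0; exact: scale_ge0.
rewrite invfM invrK EFinM muleCA.
have := scale_ge0 f x l0; case: (`|f x| * _)%E => [u| |]//= u0.
  by rewrite -EFinM !lee_fin phi_lower// ?(ltW s0).
by rewrite !gt0_muley ?lte_fin.
Qed.

End musielak_orlicz.

Section radial_controls.
Context (R : realType) (n : nat).
Hypothesis n_gt0 : (0 < n)%N.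
Variable K : R -> Rn R n -> Rn R n -> R[i].
Variable T : R -> (Rn R n -> R[i]) -> (Rn R n -> R[i]).
Hypothesis K_gauss : gaussian_bound K.
Hypothesis K_hoelder : hoelder_kernel K.
Hypothesis T_semigroup : C0_semigroup T.
Hypothesis T_kernels : has_kernels T K.

(** In terms of the maximal function M, f* <= C M((f+)^r)^(1/r) with r = 1/m. By
    [fefferman_stein] with N = n m, (f+)^r is at least a multiple of
    a^r D^n on the ball of radius delta t around y, where D = 1 + |x - y|/t; a
    ball of radius comparable with D t contains both this ball and x, and D^n is
    exactly the ratio of the volumes. The scale l is that of the modular. *)
Lemma nontangential_le_maximal_radial (m : nat) : (0 < m)%N ->
  exists2 kappa : R, 0 < kappa & forall f (G : Rn R n -> R) (l : R) x (a : R),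
    L2 f -> measurable_fun setT G -> (forall y, 0 <= G y) ->
    (\forall y \ae lebesgue_rn R n, radial_max K f y = (G y)%:E) ->
    0 < l -> 0 < a -> ((a * l)%:E < nontangential_max K f x)%E ->
    hl_level (lebesgue_rn R n) (fun y => (G y / l) `^ m%:R^-1)
      ((kappa * a) `^ m%:R^-1) x.
Proof.
move=> m0; pose N := (n * m)%N; pose r : R := m%:R^-1.
have mr0 : 0 < m%:R :> R by rewrite ltr0n.
have r0 : 0 < r by rewrite invr_gt0.
have [delta /andP[d0 d1] FS] := fefferman_stein n_gt0 K_gauss K_hoelder T_semigroup T_kernels N.
pose c0 : R := 2 ^- (n + N + 2); have c00 : 0 < c0 by rewrite invr_gt0 exprn_gt0.
pose c1 : R := (2 / n%:R) ^+ n.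
have c10 : 0 < c1 by rewrite exprn_gt0// divr_gt0// ltr0n.
pose c2 : R := 2 ^+ n; have c20 : 0 < c2 by rewrite exprn_gt0.
(* Half of the volume ratio, to get a strict inequality between averages. *)
pose theta := c1 * delta ^+ n / (2 * (c2 * 3 ^+ n)).
have th0 : 0 < theta.
  apply: divr_gt0; first exact: mulr_gt0 c10 (exprn_gt0 _ d0).
  by rewrite mulr_gt0// mulr_gt0// exprn_gt0.
exists (c0 * theta ^+ m); first exact: mulr_gt0 c00 (exprn_gt0 _ th0).
move=> f G l x a fL2 mG G0 fG l0 a0 al.
have [y [t [t0 tP]]] := FS f x (a * l) fL2 (mulr_gt0 a0 l0) al.
pose D := rel_dist x y t; have D0 : 0 < D by exact: rel_dist_gt0.
have Dt0 : 0 < D * t by exact: mulr_gt0.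
have [i [iB i0 i3]] := rational_ball_cover n_gt0 y Dt0.
have dt0 : 0 < delta * t by exact: mulr_gt0.
have D1 : 1 <= D by exact: rel_dist_ge1.
have xi : @rational_ball R n i x.
  apply: iB; rewrite /eucl_ball /= /D /rel_dist mulrDl mul1r mulfVK ?gt_eqF//.
  by rewrite ltrDr.
exists i => //; rewrite /hl_index /= -/r.
set B := rational_ball i in iB xi *.
pose B1 := eucl_ball y (delta * t).
have B1B : B1 `<=` B.
  move=> z zy; apply: iB; apply: lt_trans zy _; rewrite ltr_pM2r//.
  exact: lt_le_trans D1.
have mB : measurable B by exact: measurable_rational_ball.
have mB1 : measurable B1 by exact: measurable_eucl_ball.
have kr : (c0 * theta ^+ m * a) `^ r = (a * c0) `^ r * theta.
  rewrite (_ : c0 * theta ^+ m * a = a * c0 * theta ^+ m); last by ring.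
  rewrite powRM ?(ltW (mulr_gt0 a0 c00)) ?(ltW (exprn_gt0 _ th0))//.
  congr (_ * _); rewrite -(powR_mulrn m (ltW th0)) -powRrM mulfV ?gt_eqF//.
  exact/powRr1/ltW.
have Gz : \forall z \ae lebesgue_rn R n, B1 z -> (a * c0) `^ r * D ^+ n <= (G z / l) `^ r.
  apply: filterS fG => z Gz zy.
  have uG : cmod (kernel_op K (t ^+ 2) f z) <= G z.
    by rewrite -lee_fin -Gz; apply: ereal_sup_ubound; exists t.
  have h : a * c0 * D ^+ N <= G z / l.
    rewrite ler_pdivlMr//; apply: le_trans uG; apply: le_trans (tP z zy).
    by rewrite le_eqVlt; apply/orP; left; apply/eqP; rewrite /c0 /D; ring.
  have -> : D ^+ n = (D ^+ N) `^ r.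
    rewrite /N exprM -(powR_mulrn m) ?exprn_ge0 ?(ltW D0)// -powRrM.
    by rewrite mulfV ?gt_eqF// powRr1// exprn_ge0// ltW.
  have ac0 : 0 <= a * c0 by rewrite mulr_ge0// ltW.
  have DN0 : 0 <= D ^+ N by rewrite exprn_ge0// ltW.
  rewrite -powRM//; apply: ge0_ler_powR; rewrite ?nnegrE ?(ltW r0)//.
    exact: mulr_ge0.
  by rewrite divr_ge0// ltW.
have mGr : measurable_fun setT (fun z => ((G z / l) `^ r)%:E).
  apply/measurable_EFinP.
  apply: (measurableT_comp (f := fun u : R => (u `^ r)%R)); first exact: measurable_powR.
  exact: measurable_funM.
pose b := (a * c0) `^ r * D ^+ n.
have ac0 : 0 < (a * c0) `^ r by rewrite powR_gt0// mulr_gt0.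
have b0 : 0 < b by rewrite mulr_gt0// exprn_gt0.
apply: (@lt_le_trans _ _ (b%:E * lebesgue_rn R n B1)%E); last first.
  apply: (@le_trans _ _ (\int[lebesgue_rn R n]_(z in B1) ((G z / l) `^ r)%:E)%E).
    rewrite -integral_cst//; apply: ge0_ae_le_integral_in => [z _|z _|].
    - by rewrite lee_fin ltW.
    - by rewrite lee_fin powR_ge0.
    - by apply: filterS Gz => z H /H; rewrite lee_fin.
  apply: ge0_subset_integral => //; first exact: measurable_funTS.
  by move=> z _; rewrite lee_fin powR_ge0.
have /andP[_ h2] := lebesgue_ball_bounds (rational_point R i.1) n_gt0 i0.
have /andP[h1 _] := lebesgue_ball_bounds y n_gt0 dt0.
apply: (@le_lt_trans _ _ (((c0 * theta ^+ m * a) `^ r)%:E * (c2 * ratr i.2 ^+ n)%:E)%E).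
  by apply: lee_wpmul2l => //; rewrite lee_fin powR_ge0.
apply: (@lt_le_trans _ _ (b%:E * (c1 * (delta * t) ^+ n)%:E)%E); last first.
  by apply: lee_wpmul2l => //; rewrite lee_fin ltW.
rewrite -!EFinM lte_fin kr /b -[ltLHS]mulrA -[ltRHS]mulrA ltr_pM2l//.
apply: (@le_lt_trans _ _ (theta * (c2 * (3 * (D * t)) ^+ n))).
  apply: ler_wpM2l; first exact: ltW.
  apply: ler_wpM2l; first exact: ltW.
  by apply: lerXn2r; rewrite ?nnegrE ?(ltW i0) ?(ltW i3)// mulr_ge0// ltW.
rewrite [ltLHS](_ : _ = 2^-1 * (D ^+ n * (c1 * (delta * t) ^+ n))); last first.
  by rewrite /theta !exprMn; field; rewrite !gt_eqF//= ?exprn_gt0.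
rewrite gtr_pMl ?invf_lt1// ?ltr1n//.
exact: mulr_gt0 (exprn_gt0 _ D0) (mulr_gt0 c10 (exprn_gt0 _ dt0)).
Qed.

End radial_controls.

Theorem theorem1p9 (R : realType) (n : nat) (n_gt0 : (0 < n)%N)
    (D : set (Rn R n -> R[i])) (L : (Rn R n -> R[i]) -> (Rn R n -> R[i]))
    (T : R -> (Rn R n -> R[i]) -> (Rn R n -> R[i]))
    (K : R -> Rn R n -> Rn R n -> R[i])
    (phi : Rn R n -> R -> R) :
  densely_defined_operator D L ->
  generates D L T ->
  has_kernels T K ->
  gaussian_bound K ->
  hoelder_kernel K ->
  growth_function phi ->
  hardy_spaces_coincide phi (nontangential_max K) (radial_max K).
Proof.
move=> _ [sgT _ _] TK gK hK [orl phi_ae muck [p /andP[p0 p1] [Cl Cl0 low]] [Cu Cu0 up]].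
have phi_mono x s t : 0 <= s -> s <= t -> phi x s <= phi x t by have [+ _ _ _] := orl x; exact.
have phi0 x : phi x 0 = 0 by have [] := orl x.
have phi_gt0 x t : 0 < t -> 0 < phi x t by have [_ _ + _] := orl x; exact.
have phi_infty x : phi x t @[t --> +oo] --> +oo by have [] := orl x.
have [q [A [q1 A0 qA]]] := muckenhoupt_infty_gt1 n_gt0 phi_gt0 muck.
have q0 : 0 < q by exact: lt_trans q1.
(* r = 1/m with m > q/p, so that p - r q > 0. *)
pose m := Num.bound (q / p).
have qm : q / p < m%:R by apply: archi_boundP; rewrite divr_ge0// ltW.
have m0 : (0 < m)%N by rewrite -(ltr0n R); apply: lt_trans qm; exact: divr_gt0.
have mr0 : 0 < m%:R :> R by rewrite ltr0n.
have r0 : 0 < m%:R^-1 :> R by rewrite invr_gt0.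
have sg0 : 0 < p - m%:R^-1 * q.
  by rewrite subr_gt0 ltr_pdivrMl// -ltr_pdivrMr.
have [kappa kappa0 kP] := nontangential_le_maximal_radial n_gt0 gK hK sgT TK m0.
have [C C0 CP] := modular_inequality n_gt0 phi_mono phi0 phi_gt0 phi_infty
  phi_ae Cl0 Cu0 low up q1 A0 qA r0 kappa0 sg0.
have rad0 f x : (0 <= radial_max K f x)%E.
  apply: (@le_trans _ _ (cmod (kernel_op K (1 ^+ 2) f x))%:E).
    by rewrite lee_fin cmod_ge0.
  by apply: ereal_sup_ubound; exists 1 => //=.
have nont0 f x : (0 <= nontangential_max K f x)%E.
  exact: le_trans (rad0 f x) (radial_max_le K f x).
have radle f l : 0 < l ->
    (modular phi (radial_max K f) l <= modular phi (nontangential_max K f) l)%E.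
  by move=> l0; apply: le_modular => // x; exact: radial_max_le.
have main f l : L2 f -> (modular phi (radial_max K f) 1 < +oo)%E -> 0 < l ->
    (modular phi (nontangential_max K f) l <= C%:E * modular phi (radial_max K f) l)%E.
  move=> fL2 foo l0.
  have mrad := measurable_radial_max n_gt0 gK hK fL2.
  have radfin := modular_fin_num phi_mono phi0 mrad foo.
  pose G x := fine (radial_max K f x).
  have mG : measurable_fun setT G by exact: measurableT_comp.
  have G0 x : 0 <= G x by exact: fine_ge0.
  have fG : \forall x \ae lebesgue_rn R n, radial_max K f x = (G x)%:E.
    apply: filterS radfin => x; rewrite gee0_abs// => xoo.
    by rewrite fineK// ge0_fin_numE.
  have -> : modular phi (radial_max K f) l = (\int[lebesgue_rn R n]_x (phi x (G x / l))%:E)%E.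
    apply: ae_eq_lower_integral; apply: filterS fG => x ->.
    by rewrite gee0_abs ?lee_fin// -EFinM.
  apply: CP => [|x|x|x a a0].
  - exact: measurable_funM.
  - by rewrite divr_ge0// ltW.
  - by rewrite mule_ge0// lee_fin invr_ge0 ltW.
  rewrite gee0_abs// lte_pdivlMr// -EFinM => al.
  exact: (kP f G l x a fL2 mG G0 fG l0 a0 al).
split.
  apply/seteqP; split => f [fL2 [mf foo]]; split => //; split.
  - by apply: ae_measurable_fun_ae; exact: measurable_radial_max.
  - exact: le_lt_trans (radle f 1 ltr01) foo.
  - by apply: ae_measurable_fun_ae; exact: measurable_nontangential_max.
  - apply: le_lt_trans (main f 1 fL2 foo ltr01) _.
    by rewrite lte_mul_pinfty// lee_fin ltW.
(* The dilation for which Cl s^p C <= 1. *)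
pose s := Order.min 1 ((Cl * C)^-1 `^ p^-1).
have ClC0 : 0 < Cl * C by exact: mulr_gt0.
have s0 : 0 < s by rewrite lt_min ltr01 powR_gt0// invr_gt0.
have s1 : s <= 1 by rewrite ge_min lexx.
have sp : Cl * s `^ p * C <= 1.
  rewrite mulrAC -ler_pdivlMl// mulr1.
  have -> : (Cl * C)^-1 = ((Cl * C)^-1 `^ p^-1) `^ p.
    by rewrite -powRrM mulVf ?gt_eqF// powRr1// invr_ge0 ltW.
  apply: ge0_ler_powR; rewrite ?nnegrE ?(ltW p0) ?(ltW s0) ?powR_ge0//.
  by rewrite ge_min lexx orbT.
exists s^-1; first by rewrite invr_gt0.
move=> f [fL2 [_ foo]]; split.
  apply: le_Lphi_norm => [|l l0 fl]; first by rewrite invr_gt0.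
  apply: le_trans (modular_shrink phi_mono phi0 Cl0 low _ l0 _) _; first by rewrite s0.
  have foo' : (modular phi (radial_max K f) 1 < +oo)%E.
    exact: le_lt_trans (radle f 1 ltr01) foo.
  have c0 : 0 <= Cl * s `^ p by rewrite mulr_ge0 ?powR_ge0// ltW.
  apply: le_trans (lee_wpmul2l _ (main f l fL2 foo' l0)) _; first by rewrite lee_fin.
  rewrite muleA -EFinM -[leRHS]mule1.
  apply: lee_pmul => //; first by rewrite lee_fin mulr_ge0// ltW.
  apply: integral_ge0 => x _; apply: growth_ext_ge0 => //.
  by rewrite mule_ge0// lee_fin invr_ge0 ltW.
apply: (@le_trans _ _ (1%:E * Lphi_norm phi (nontangential_max K f))%E).
  apply: le_Lphi_norm => // l l0; rewrite mul1r; apply: le_trans.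
  exact: radle.
apply: lee_wpmul2r; first exact: Lphi_norm_ge0.
by rewrite lee_fin invf_ge1.
Qed.
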